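(* Let $(M,F)$ be a generalized isotropic Berwald manifold of dimension $n>2$, i.e. a Finsler manifold for which there are functions $\mu=\mu(x,y)$ and $\lambda=\lambda(x,y)$ on $TM_0$, homogeneous in $y$ of degrees $0$ and $-1$ respectively, with $$B^i_{\ jkl}=\mu\, C_{jkl}\,\ell^i+\lambda\,(h^i_j h_{kl}+h^i_k h_{jl}+h^i_l h_{jk}).$$ Then $F$ is R-quadratic if and only if $F$ is a stretch metric (i.e. $\Sigma_{ijkl}=0$) and its $\bar E$-curvature vanishes (i.e. $\bar E_{jkl}=0$).
   Context: $M$ is an $n$-dimensional $C^\infty$ manifold and $TM_0=TM\setminus\{0\}$ is the slit tangent bundle, with standard local coordinates $(x^i,y^i)$. A Finsler metric is a function $F:TM\to[0,\infty)$ that is $C^\infty$ on $TM_0$, positively $1$-homogeneous on the fibers, and such that $g_{ij}=\frac12\frac{\partial^2 F^2}{\partial y^i\partial y^j}$ is positive definite at every $y\in T_xM\setminus\{0\}$. Indices are lowered and raised with $g_{ij}$ and its inverse $g^{ij}$. Homogeneity is positive homogeneity in $y$. Notation: $y_i=g_{ij}y^j$; $\ell^i=y^i/F$; $h_{ij}=g_{ij}-F^{-2}y_iy_j$, $h^i_j=\delta^i_j-F^{-2}y^iy_j$; Cartan torsion $C_{ijk}=\frac12\frac{\partial g_{ij}}{\partial y^k}$; spray coefficients $G^i=\frac14 g^{il}\{\frac{\partial^2F^2}{\partial x^k\partial y^l}y^k-\frac{\partial F^2}{\partial x^l}\}$; Berwald curvature $B^i_{\ jkl}=\frac{\partial^3G^i}{\partial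 y^j\partial y^k\partial y^l}$; mean Berwald curvature $E_{jk}=\frac12B^m_{\ jkm}$. The symbol ''$|$'' denotes horizontal covariant derivative with respect to the Berwald connection: with $\delta_k=\frac{\partial}{\partial x^k}-\frac{\partial G^m}{\partial y^k}\frac{\partial}{\partial y^m}$ and $G^m_{ik}=\frac{\partial^2G^m}{\partial y^i\partial y^k}$, one has $T^i_{\ j|k}=\delta_kT^i_{\ j}+T^m_{\ j}G^i_{mk}-T^i_{\ m}G^m_{jk}$, and analogously for other tensors. Landsberg curvature: $L_{ijk}=C_{ijk|s}y^s$. Stretch curvature: $\Sigma_{ijkl}=2(L_{ijk|l}-L_{ijl|k})$. $\bar E$-curvature: $\bar E_{jkl}=E_{jk|l}$. Riemann curvature: $R^i_{\ k}=2\frac{\partial G^i}{\partial x^k}-y^j\frac{\partial^2G^i}{\partial x^j\partial y^k}+2G^j\frac{\partial^2G^i}{\partial y^j\partial y^k}-\frac{\partial G^i}{\partial y^j}\frac{\partial G^j}{\partial y^k}$. $F$ is R-quadratic if at each point $x\in M$ the components $R^i_{\ k}(x,y)$ are quadratic forms in $y\in T_xM$; equivalently $R^i_{\ jkl}=\frac13\frac{\partial}{\partial y^j}\{\frac{\partial R^i_{\ k}}{\partial y^l}-\frac{\partial R^i_{\ l}}{\partial y^k}\}$ depends on $x$ only. *)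

(* Defs.v *)
From HB Require Import structures.
From mathcomp Require Import all_boot all_order all_algebra.
From mathcomp Require Import all_classical all_reals all_analysis.

Set Implicit Arguments.
Unset Strict Implicit.
Unset Printing Implicit Defensive.

Import Order.TTheory GRing.Theory Num.Theory.
Import numFieldNormedType.Exports.
Local Open Scope classical_set_scope.
Local Open Scope ring_scope.

(* C^oo on an open set U: every iterated directional derivative of f is
   Frechet differentiable (hence continuous) at every point of U. *)
Definition smooth_on (R : realType) (V W : normedModType R) (U : set V)
    (f : V -> W) : Prop :=
  forall (s : seq V) (x : V), U x ->
    differentiable (foldr (fun v g => fun z => 'D_v g z) f s) x.

(* An n-dimensional C^oo manifold, with a (not necessarily maximal) smooth
   atlas.  [chart_inv i] is only meaningful on the image of the chart. *)
Record smooth_manifold (R : realType) (n : nat) := SmoothManifold {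
  carrier :> topologicalType;
  carrier_hausdorff : hausdorff_space carrier;
  carrier_second_countable : @second_countable carrier;
  chart_index : Type;
  chart_dom : chart_index -> set carrier;
  chart : chart_index -> carrier -> 'rV[R]_n;
  chart_inv : chart_index -> 'rV[R]_n -> carrier;
  chart_dom_open : forall i, open (chart_dom i);
  chart_image_open : forall i, open (chart i @` chart_dom i);
  chartK : forall i p, chart_dom i p -> chart_inv i (chart i p) = p;
  chart_continuous : forall i p, chart_dom i p ->
    {for p, continuous (chart i)};
  chart_inv_continuous : forall i x, (chart i @` chart_dom i) x ->
    {for x, continuous (chart_inv i)};
  chart_cover : forall p, exists i, chart_dom i p;
  chart_smooth : forall i j,
    smooth_on (chart i @` (chart_dom i `&` chart_dom j))
      (chart j \o chart_inv i)
}.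
Arguments chart_dom {R n} _ _ _.
Arguments chart {R n} _ _ _.
Arguments chart_inv {R n} _ _ _.

Lemma diff_comp_near (R : realType) (U V W : normedModType R) (f : U -> W)
    (g : V -> W) (k : U -> V) (x y : U) :
  {near x, f =1 g \o k} -> differentiable k x -> differentiable g (k x) ->
  differentiable f x -> 'd f x y = 'd g (k x) ('d k x y).
Proof.
move=> fgk dk dg df; rewrite -(deriveE _ df) (near_eq_derive _ fgk).
have dgk : differentiable (g \o k) x by exact: differentiable_comp.
by rewrite (deriveE _ dgk) (diff_comp dk dg).
Qed.

Section TangentBundle.
Variables (R : realType) (n : nat) (M : smooth_manifold R n).

Definition chart_image (i : chart_index M) : set 'rV[R]_n :=
  chart M i @` chart_dom M i.

Definition transition (i j : chart_index M) : 'rV[R]_n -> 'rV[R]_n :=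
  chart M j \o chart_inv M i.

(* A tangent vector at p is the family of its components in all the charts
   around p, related by the differentials of the transition maps; components
   in the other charts are set to 0, so that equality in this record is
   equality of tangent vectors. *)
Record tangent_bundle := TangentVector {
  foot : M;
  component : chart_index M -> 'rV[R]_n;
  component_transition : forall i j,
    chart_dom M i foot -> chart_dom M j foot ->
    component j = 'd (transition i j) (chart M i foot) (component i);
  component_out : forall i, ~ chart_dom M i foot -> component i = 0
}.

Section OfCoordinates.
Variables (i : chart_index M) (x y : 'rV[R]_n).

Let p : M := chart_inv M i x.

Definition coord_component (j : chart_index M) : 'rV[R]_n :=
  if `[< chart_image i x /\ chart_dom M j p >]
  then 'd (transition i j) x y else 0.

Lemma coord_component_transition j k :
  chart_dom M j p -> chart_dom M k p ->
  coord_component k = 'd (transition j k) (chart M j p) (coord_component j).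
Proof.
move=> pj pk; rewrite /coord_component.
have [xi|xNi] := pselect (chart_image i x); last first.
  by rewrite !asboolF ?linear0//; case.
rewrite !asboolT//.
have [q qi qx] := xi.
have pq : p = q by rewrite /p -qx chartK.
have sm a : chart_dom M a p -> differentiable (transition i a) x.
  move=> pa; apply: (@chart_smooth _ _ M i a [::]).
  by exists q => //; split => //; rewrite -pq.
have sjk : differentiable (transition j k) (chart M j p).
  by apply: (@chart_smooth _ _ M j k [::]); exists p.
have ext : {near x, transition i k =1 transition j k \o transition i j}.
  have : \forall z \near x, chart_dom M j (chart_inv M i z).
    apply: (chart_inv_continuous xi); apply: open_nbhs_nbhs.
    by split => //; exact: chart_dom_open.
  by apply: filterS => z zj; rewrite /transition /= chartK.
exact: (diff_comp_near y ext (sm j pj) sjk (sm k pk)).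
Qed.

Lemma coord_component_out j : ~ chart_dom M j p -> coord_component j = 0.
Proof. by move=> pj; rewrite /coord_component asboolF//; case. Qed.

(* The tangent vector y^k d/dx^k at the point with coordinates x in the chart
   i; junk (a zero vector) when x is not in the image of the chart. *)
Definition of_coordinates : tangent_bundle :=
  TangentVector coord_component_transition coord_component_out.

End OfCoordinates.

(* A function on TM in the standard local coordinates (x, y) of the chart i. *)
Definition local_expr (f : tangent_bundle -> R) (i : chart_index M)
    (z : 'rV[R]_n * 'rV[R]_n) : R :=
  f (of_coordinates i z.1 z.2).

(* The coordinate domain of the slit tangent bundle over the chart i. *)
Definition slit_domain (i : chart_index M) : set ('rV[R]_n * 'rV[R]_n) :=
  [set z | chart_image i z.1 /\ z.2 <> 0].

End TangentBundle.

(* Local tensors of a metric with expression F in coordinates (x, y).  Indices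
   are listed as in the classical notation, a contravariant index coming
   first; [conn i k] is dG^i/dy^k and [conn_dy i j k] is d^2 G^i/dy^j dy^k. *)
Section LocalTensors.
Variables (R : realType) (n : nat).
Local Notation coords := ('rV[R]_n * 'rV[R]_n)%type.

Definition dx (k : 'I_n) (f : coords -> R) (z : coords) : R :=
  'D_(delta_mx 0 k, 0) f z.
Definition dy (k : 'I_n) (f : coords -> R) (z : coords) : R :=
  'D_(0, delta_mx 0 k) f z.
Definition yc (k : 'I_n) (z : coords) : R := z.2 0 k.

Variable F : coords -> R.

Definition Fsq (z : coords) : R := F z ^+ 2.

Definition metric (i j : 'I_n) (z : coords) : R := 2^-1 * dy i (dy j Fsq) z.

Definition metric_inv (i j : 'I_n) (z : coords) : R :=
  invmx (\matrix_(a < n, b < n) metric a b z) i j.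

Definition y_low (i : 'I_n) (z : coords) : R :=
  \sum_(j < n) metric i j z * yc j z.

Definition ell (i : 'I_n) (z : coords) : R := yc i z / F z.

Definition angular (i j : 'I_n) (z : coords) : R :=
  metric i j z - y_low i z * y_low j z / F z ^+ 2.

Definition angular_mixed (i j : 'I_n) (z : coords) : R :=
  (i == j)%:R - yc i z * y_low j z / F z ^+ 2.

Definition cartan (i j k : 'I_n) (z : coords) : R := 2^-1 * dy k (metric i j) z.

Definition spray (i : 'I_n) (z : coords) : R :=
  4^-1 * \sum_(l < n) metric_inv i l z *
    ((\sum_(k < n) dx k (dy l Fsq) z * yc k z) - dx l Fsq z).

Definition conn (i k : 'I_n) : coords -> R := dy k (spray i).
Definition conn_dy (i j k : 'I_n) : coords -> R := dy j (dy k (spray i)).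

Definition berwald (i j k l : 'I_n) : coords -> R :=
  dy j (dy k (dy l (spray i))).

Definition mean_berwald (j k : 'I_n) (z : coords) : R :=
  2^-1 * \sum_(m < n) berwald m j k m z.

Definition hdelta (k : 'I_n) (f : coords -> R) (z : coords) : R :=
  dx k f z - \sum_(m < n) conn m k z * dy m f z.

(* Horizontal Berwald covariant derivatives T_{ij|k} and T_{ijk|l} of
   covariant tensors of order 2 and 3. *)
Definition hcov2 (T : 'I_n -> 'I_n -> coords -> R) (i j k : 'I_n)
    (z : coords) : R :=
  hdelta k (T i j) z
  - \sum_(m < n) T m j z * conn_dy m i k z
  - \sum_(m < n) T i m z * conn_dy m j k z.

Definition hcov3 (T : 'I_n -> 'I_n -> 'I_n -> coords -> R) (i j k l : 'I_n)
    (z : coords) : R :=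
  hdelta l (T i j k) z
  - \sum_(m < n) T m j k z * conn_dy m i l z
  - \sum_(m < n) T i m k z * conn_dy m j l z
  - \sum_(m < n) T i j m z * conn_dy m k l z.

Definition landsberg (i j k : 'I_n) (z : coords) : R :=
  \sum_(s < n) hcov3 cartan i j k s z * yc s z.

Definition stretch (i j k l : 'I_n) (z : coords) : R :=
  2 * (hcov3 landsberg i j k l z - hcov3 landsberg i j l k z).

Definition mean_berwald_bar (j k l : 'I_n) : coords -> R :=
  hcov2 mean_berwald j k l.

Definition riemann (i k : 'I_n) (z : coords) : R :=
  2 * dx k (spray i) z
  - \sum_(j < n) yc j z * dx j (dy k (spray i)) z
  + 2 * \sum_(j < n) spray j z * dy j (dy k (spray i)) z
  - \sum_(j < n) dy j (spray i) z * dy k (spray j) z.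

End LocalTensors.

Section Finsler.
Variables (R : realType) (n : nat) (M : smooth_manifold R n).
Implicit Types F f : tangent_bundle M -> R.

Definition slit_homogeneous (d : int) f : Prop :=
  forall i x y (t : R), slit_domain i (x, y) -> 0 < t ->
    local_expr f i (x, t *: y) = t ^ d * local_expr f i (x, y).

Record finsler_metric F : Prop := FinslerMetric {
  finsler_ge0 : forall v, 0 <= F v;
  finsler_smooth : forall i, smooth_on (slit_domain i) (local_expr F i);
  finsler_homogeneous : forall i x y (t : R), chart_image i x -> 0 < t ->
    local_expr F i (x, t *: y) = t * local_expr F i (x, y);
  finsler_posdef : forall i z, slit_domain i z ->
    forall v : 'rV[R]_n, v != 0 ->
      0 < \sum_(a < n) \sum_(b < n)
            metric (local_expr F i) a b z * v 0 a * v 0 b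
}.

Definition generalized_isotropic_berwald F : Prop :=
  exists mu lam : tangent_bundle M -> R,
    [/\ slit_homogeneous 0 mu, slit_homogeneous (-1) lam &
      forall c z, slit_domain c z ->
        let Fc := local_expr F c in
        forall i j k l : 'I_n,
          berwald Fc i j k l z =
            local_expr mu c z * cartan Fc j k l z * ell Fc i z
            + local_expr lam c z *
              (angular_mixed Fc i j z * angular Fc k l z
               + angular_mixed Fc i k z * angular Fc j l z
               + angular_mixed Fc i l z * angular Fc j k z)].

(* y = 0 is excluded: G^i, hence R^i_k, is only defined on the slit bundle. *)
Definition R_quadratic F : Prop :=
  forall c x, chart_image c x ->
    forall i k : 'I_n, exists a : 'M[R]_n, forall y, y <> 0 ->
      riemann (local_expr F c) i k (x, y) =
        \sum_(j < n) \sum_(l < n) a j l * y 0 j * y 0 l.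

Definition stretch_metric F : Prop :=
  forall c z, slit_domain c z ->
    forall i j k l : 'I_n, stretch (local_expr F c) i j k l z = 0.

Definition mean_berwald_bar_vanishes F : Prop :=
  forall c z, slit_domain c z ->
    forall j k l : 'I_n, mean_berwald_bar (local_expr F c) j k l z = 0.

End Finsler.

(* Main.v *)
From HB Require Import structures.
From mathcomp Require Import all_boot all_order all_algebra.
From mathcomp Require Import all_classical all_reals all_analysis.
From mathcomp Require Import ring lra.
Require Import Defs.

(** Write N, G^i_jk, B for the first, second and third vertical derivatives of
    the spray coefficients, d_k for the horizontal derivations, a bar for the
    horizontal covariant derivative, and P_jkl = y_i B^i_jkl.

    The first ingredient is that d_k kills F^2.  Differentiating this identity
    vertically twice gives g_ij|k = P_ijk ([hcov2_metric]); one more derivative,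
    contracted with y, gives L_ijk = - P_ijk / 2 ([landsbergAE]).  So the
    stretch condition says that P_ijk|l is symmetric in k and l.  Contracting
    the isotropy condition with y_i also shows that mu C_jkl / F is
    P_jkl / F^2, while a trace recovers lambda from B: the condition reads
      B^i_jkl = F^-2 P_jkl y^i + lambda (h^i_j h_kl + h^i_k h_jl + h^i_l h_jk)
    with smooth coefficients, although mu itself may be irregular where the
    Cartan torsion vanishes.

    The second ingredient is the curvature W^i_kl = d_k N^i_l - d_l N^i_k of the
    nonlinear connection.  It satisfies R^i_k = W^i_kl y^l, its vertical
    derivatives obey a cyclic identity which turns the vertical curl of R into
    3 W, and its second vertical derivatives are B^i_jlm|k - B^i_jkm|l.  Hence R
    is quadratic in y exactly when B^i_jkl|m is symmetric in l and m
    ([curvature_linear_iff]).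

    The third ingredient is a trace argument ([isotropic_symmetry_iff]).  Since
    y^i and h^i_j are parallel and h_ij|k = P_ijk, the derivative B^i_jkl|m is
    explicit.  If it is symmetric, contraction with y_i gives the stretch
    condition; the trace over i and j gives
    lambda_|m h_kl = lambda_|l h_km, which forces lambda_|m = 0 because n > 2;
    the trace over i and l then gives (n - 2) lambda P = 0.  These two equations
    amount to the vanishing of the E-bar curvature, which is a multiple of
    lambda_|l h_jk + lambda P_jkl.  Conversely that expression being zero makes
    lambda_|l h_jk symmetric in k and l, so lambda_|l = 0, lambda P = 0, and
    only the term F^-2 P_jkl|m y^i is left, which the stretch condition makes
    symmetric.

    All these identities are polynomial in the derivatives of F^2 and in the
    inverses of F^2 and of the metric, so they are proved in an abstract
    commutative ring with commuting derivations d/dx^i and d/dy^i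
    ([finsler_ring]).  The smooth functions on the slit domain of a chart form
    such a ring ([chart_finsler_ring]): smoothness survives products and
    inverses ([closure_smooth_on]) and second derivatives commute
    ([derive_comm]).  Finally the coefficients of the quadratic form R^i_k are
    constant along a fibre because R^n without the origin is connected
    ([fiber_const]). *)

Set Implicit Arguments.
Unset Strict Implicit.
Unset Printing Implicit Defensive.

Import Order.TTheory GRing.Theory Num.Theory.
Import numFieldNormedType.Exports.
Local Open Scope classical_set_scope.
Local Open Scope ring_scope.

(** * Derivations of a commutative ring *)

Record derivation (A : comPzRingType) (D : A -> A) : Prop := Derivation {
  derD : forall a b, D (a + b) = D a + D b;
  derM : forall a b, D (a * b) = D a * b + a * D b
}.

Section DerivationTheory.
Variables (A : comPzRingType) (D : A -> A).
Hypothesis hD : derivation D.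

Lemma der0 : D 0 = 0.
Proof. by apply: (addrI (D 0)); rewrite -(derD hD) !addr0. Qed.

Lemma derN a : D (- a) = - D a.
Proof. by apply: (addrI (D a)); rewrite -(derD hD) !subrr der0. Qed.

Lemma derB a b : D (a - b) = D a - D b.
Proof. by rewrite (derD hD) derN. Qed.

Lemma der1 : D 1 = 0.
Proof.
by apply: (addrI (D 1)); rewrite addr0 -[in RHS](mulr1 1) (derM hD) mulr1 mul1r.
Qed.

Lemma der_sum n (f : 'I_n -> A) : D (\sum_i f i) = \sum_i D (f i).
Proof. exact: (big_morph D (derD hD) der0). Qed.

Lemma der_sumM n (f g : 'I_n -> A) :
  D (\sum_i f i * g i) = \sum_i D (f i) * g i + \sum_i f i * D (g i).
Proof.
by rewrite der_sum -big_split; apply: eq_bigr => i _; rewrite (derM hD).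
Qed.

Lemma derMn a m : D (a *+ m) = D a *+ m.
Proof. by elim: m => [|m IH]; rewrite ?mulr0n ?der0// !mulrS (derD hD) IH. Qed.

Lemma der_natl m a : D (m%:R * a) = m%:R * D a.
Proof. by rewrite !mulr_natl derMn. Qed.

Lemma der_bool (b : bool) : D b%:R = 0.
Proof. by rewrite -[b%:R]/(1 *+ b) derMn der1 mul0rn. Qed.

(** Differentiate a * b = 1; this gives the constancy of 1/2 and of F^-2. *)
Lemma der_inv a b : a * b = 1 -> D a = 0 -> D b = 0.
Proof.
move=> ab Da; have := congr1 D ab; rewrite der1 (derM hD) Da mul0r add0r => aDb.
by rewrite -[D b]mul1r -ab mulrAC aDb mul0r.
Qed.
End DerivationTheory.

Lemma sum_deltar (A : pzRingType) n (f : 'I_n -> A) i :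
  \sum_j f j * (i == j)%:R = f i.
Proof.
rewrite (bigD1 i)//= eqxx mulr1 big1 ?addr0// => j ji.
by rewrite eq_sym (negbTE ji) mulr0.
Qed.

Lemma sum_deltal (A : pzRingType) n (f : 'I_n -> A) i :
  \sum_j (i == j)%:R * f j = f i.
Proof.
rewrite -[RHS](sum_deltar f i); apply: eq_bigr => j _.
by case: (i == j); rewrite (mul0r, mul1r) (mulr0, mulr1).
Qed.

(** * Homogeneous energies and the fundamental tensor *)

(** The abstract setting of the tensor calculus: [dX i] and [dY i] stand for
    d/dx^i and d/dy^i, [coordy] for the fibre coordinates and [energy] for F^2,
    which enters only through Euler's relation for degree 2.  The inverses of
    F^2 and of the metric come later, in [finsler_ring], because in a chart
    their existence rests on y^i y_i = F^2 ([y_y_low]). *)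
Record energy_ring (n : nat) := EnergyRing {
  fring :> comPzRingType;
  dX : 'I_n -> fring -> fring;
  dY : 'I_n -> fring -> fring;
  dX_der : forall i, derivation (dX i);
  dY_der : forall i, derivation (dY i);
  dYC : forall i j a, dY i (dY j a) = dY j (dY i a);
  dYXC : forall i j a, dY i (dX j a) = dX j (dY i a);
  coordy : 'I_n -> fring;
  dX_y : forall i k, dX i (coordy k) = 0;
  dY_y : forall i k, dY i (coordy k) = (i == k)%:R;
  energy : fring;
  energy_euler : \sum_k coordy k * dY k energy = 2 * energy;
  half : fring;
  half2 : 2 * half = 1
}.

Section EnergyRing.
Variables (n : nat) (S : energy_ring n).
Implicit Types (f : S) (a b c d i j k l m r : 'I_n).

Local Notation X := (@dX n S).
Local Notation Y := (@dY n S).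
Local Notation y := (@coordy n S).
Local Notation L := (@energy n S).
Local Notation hf := (@half n S).

Let Xd := @dX_der n S.
Let Yd := @dY_der n S.

Lemma half_double f : hf * (2 * f) = f.
Proof. by rewrite mulrA [hf * 2]mulrC half2 mul1r. Qed.

Lemma der_half D : derivation D -> D hf = 0.
Proof.
move=> hD; apply: (@der_inv _ _ hD 2); first exact: half2.
by rewrite -[2]mulr1 der_natl// der1// mulr0.
Qed.

(** A function is homogeneous of degree d in y exactly when this operator
    multiplies it by d. *)
Definition euler f : S := \sum_k y k * Y k f.
Local Notation Eu := euler.

Lemma euler_der : derivation Eu.
Proof.
split=> a b; rewrite /Eu.
  rewrite -big_split; apply: eq_bigr => k _; rewrite (derD (Yd k)) mulrDr//.
rewrite mulr_suml mulr_sumr -big_split; apply: eq_bigr => k _ /=.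
by rewrite (derM (Yd k)); ring.
Qed.

Lemma euler_y i : Eu (y i) = y i.
Proof.
rewrite /Eu; under eq_bigr do rewrite dY_y eq_sym.
exact: sum_deltar.
Qed.

(** A vertical derivative lowers the degree of homogeneity by one; this
    commutation rule replaces every appeal to homogeneity below. *)
Lemma euler_dY k f : Eu (Y k f) = Y k (Eu f) - Y k f.
Proof.
rewrite /Eu (der_sumM (Yd k)).
under [X in X + _ - _]eq_bigr do rewrite dY_y.
rewrite sum_deltal [X in X - _]addrC addrK; apply: eq_bigr => j _.
by rewrite dYC.
Qed.

Lemma euler_dX k f : Eu (X k f) = X k (Eu f).
Proof.
rewrite /Eu (der_sumM (Xd k)).
rewrite [X in _ = X + _]big1 ?add0r; last by move=> j _; rewrite dX_y mul0r.
by apply: eq_bigr => j _; rewrite dYXC.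
Qed.

Definition metricA i j : S := hf * Y i (Y j L).
Local Notation gm := metricA.
Definition y_lowA i : S := \sum_j gm i j * y j.
Local Notation yl := y_lowA.

Lemma metricAC i j : gm i j = gm j i.
Proof. by rewrite /gm dYC. Qed.

(** F^2 has degree 2, so its first vertical derivatives have degree 1. *)
Lemma dYdY_energy_y i : \sum_j Y i (Y j L) * y j = Y i L.
Proof.
have -> : \sum_j Y i (Y j L) * y j = Eu (Y i L).
  by apply: eq_bigr => j _; rewrite mulrC dYC.
by rewrite euler_dY /Eu energy_euler (der_natl (Yd i)); ring.
Qed.

Lemma y_lowAE i : yl i = hf * Y i L.
Proof.
rewrite -[Y i L]dYdY_energy_y mulr_sumr; apply: eq_bigr => j _.
by rewrite mulrA.
Qed.

Lemma dY_energy i : Y i L = 2 * yl i.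
Proof. by rewrite y_lowAE mulrA half2 mul1r. Qed.

Lemma y_y_low : \sum_i y i * yl i = L.
Proof.
rewrite -[RHS]half_double -energy_euler mulr_sumr.
by apply: eq_bigr => i _; rewrite y_lowAE mulrCA.
Qed.

Lemma dY_y_low i j : Y i (yl j) = gm i j.
Proof. by rewrite y_lowAE (derM (Yd i)) (der_half (Yd i)) mul0r add0r. Qed.

End EnergyRing.

(** * Spray, Berwald connection and curvature *)

Record finsler_ring (n : nat) := FinslerRing {
  fenergy :> energy_ring n;
  energyV : fenergy;
  energyK : energy fenergy * energyV = 1;
  ginv : 'I_n -> 'I_n -> fenergy;
  ginvK : forall i j,
    \sum_l @metricA n fenergy i l * ginv l j = (i == j)%:R;
  torsion_free : forall m (a : fenergy), m.+1%:R * a = 0 -> a = 0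
}.

Section FinslerRing.
Variables (n : nat) (S : finsler_ring n).
Implicit Types (f : S) (a b c d i j k l m r : 'I_n).

Local Notation X := (@dX n S).
Local Notation Y := (@dY n S).
Local Notation y := (@coordy n S).
Local Notation L := (@energy n S).
Local Notation LV := (@energyV n S).
Local Notation hf := (@half n S).
Local Notation gi := (@ginv n S).
Local Notation gm := (@metricA n S).
Local Notation yl := (@y_lowA n S).
Local Notation Eu := (@euler n S).

Let Xd := @dX_der n S.
Let Yd := @dY_der n S.
Let euler_der := @euler_der n S.

(** The inverse is postulated on one side only; the metric being symmetric, its
    transpose is an inverse on the other side. *)
Lemma ginvC i j : gi i j = gi j i.
Proof.
have -> : gi i j = \sum_k \sum_l gi l i * gm l k * gi k j.
  rewrite -[LHS](sum_deltal (fun k => gi k j)); apply: eq_bigr => k _.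
  rewrite -mulr_suml eq_sym -ginvK; congr (_ * _); apply: eq_bigr => l _.
  by rewrite metricAC mulrC.
rewrite exchange_big -[RHS](sum_deltar (fun l => gi l i)).
apply: eq_bigr => l _ /=; rewrite [j == _]eq_sym -ginvK mulr_sumr.
by apply: eq_bigr => k _; ring.
Qed.

(** Nondegeneracy lets one prove identities for the spray from the implicit
    equation [spray_eq], which does not mention the inverse metric. *)
Lemma metricA_inj (v : 'I_n -> S) :
  (forall i, \sum_j gm i j * v j = 0) -> forall k, v k = 0.
Proof.
move=> gv k; rewrite -(sum_deltal v k).
under eq_bigr => j _.
  rewrite eq_sym -ginvK mulr_suml.
  under eq_bigr do rewrite metricAC -mulrA mulrCA.
  over.
by rewrite exchange_big big1// => i _; rewrite -mulr_sumr gv mulr0.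
Qed.

Definition sprayA i : S :=
  hf * hf * \sum_l gi i l * ((\sum_k X k (Y l L) * y k) - X l L).
Local Notation G := sprayA.
Definition connA i k : S := Y k (G i).
Local Notation N := connA.
Definition conn_dyA i j k : S := Y j (Y k (G i)).
Local Notation Ga := conn_dyA.
Definition berwaldA i j k l : S := Y j (Y k (Y l (G i))).
Local Notation B := berwaldA.

(** The Euler-Lagrange form of the definition of the spray, with the index
    lowered. *)
Lemma spray_eq i : 4 * \sum_l gm i l * G l = \sum_k X k (Y i L) * y k - X i L.
Proof.
set s := fun l => \sum_k X k (Y l L) * y k - X l L.
rewrite -[RHS]/(s i) -(sum_deltal s i).
transitivity (\sum_j \sum_l gm i l * gi l j * s j).
  rewrite exchange_big mulr_sumr; apply: eq_bigr => l _.
  rewrite /sprayA !mulr_sumr; apply: eq_bigr => j _; rewrite -/(s j).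
  have e : 4 * (hf * hf) = 1.
    by transitivity ((2 * hf) * (2 * hf)); [ring | rewrite half2 mulr1].
  by transitivity (4 * (hf * hf) * (gm i l * gi l j * s j)); [ring | rewrite e mul1r].
by apply: eq_bigr => j _; rewrite -mulr_suml ginvK.
Qed.

Lemma euler_metric i j : Eu (gm i j) = 0.
Proof.
rewrite /gm (derM euler_der) (der_half euler_der) mul0r add0r !euler_dY /Eu.
by rewrite energy_euler (der_natl (Yd j)) (derB (Yd i)) (der_natl (Yd i)); ring.
Qed.

(** The spray has degree 2: both sides of [spray_eq] have degree 2, and the
    metric, of degree 0 and nondegenerate, can be cancelled. *)
Lemma euler_spray i : Eu (G i) = 2 * G i.
Proof.
apply/eqP; rewrite -subr_eq0; apply/eqP; move: i.
apply: (@metricA_inj (fun i => Eu (G i) - 2 * G i)) => i.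
have := congr1 Eu (spray_eq i).
rewrite (der_natl euler_der) (der_sumM euler_der).
rewrite [X in _ * (X + _)]big1 ?add0r; last by move=> j _; rewrite euler_metric mul0r.
rewrite (derB euler_der) (der_sumM euler_der) euler_dX /Eu energy_euler.
under [X in _ = X + _ - _]eq_bigr => j _.
  rewrite -/(Eu _) euler_dX euler_dY /Eu energy_euler (der_natl (Yd i)).
  rewrite (_ : 2 * Y i L - _ = Y i L); last by ring.
  over.
under [X in _ = _ + X - _]eq_bigr => j _ do rewrite -/(Eu _) euler_y.
rewrite (der_natl (Xd i)).
under [X in 4 * X]eq_bigr => j _ do rewrite -/(Eu _).
set s := \sum_j X j _ * _ => h.
(* It remains to compare 4 g (E G) with 4 g (2 G). *)
apply: (@torsion_free _ S 3).
under eq_bigr do rewrite mulrBr mulrCA.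
rewrite sumrB -mulr_sumr mulrBr h [4 * (2 * _)]mulrCA spray_eq -/s.
by ring.
Qed.

Lemma euler_conn i k : Eu (N i k) = N i k.
Proof. by rewrite euler_dY euler_spray (der_natl (Yd k)) /N; ring. Qed.

Lemma euler_conn_dy i j k : Eu (Ga i j k) = 0.
Proof. by rewrite euler_dY euler_conn subrr. Qed.

Lemma berwaldC12 i j k l : B i j k l = B i k j l. Proof. exact: dYC. Qed.
Lemma berwaldC23 i j k l : B i j k l = B i j l k.
Proof. by rewrite /B [Y k _]dYC. Qed.
Lemma conn_dyC i j k : Ga i j k = Ga i k j. Proof. exact: dYC. Qed.

Lemma conn_y i : \sum_k N i k * y k = 2 * G i.
Proof. by rewrite -euler_spray; apply: eq_bigr => k _; rewrite mulrC. Qed.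
Lemma conn_dy_y i j : \sum_k Ga i j k * y k = N i j.
Proof.
by rewrite -[RHS]euler_conn; apply: eq_bigr => k _; rewrite mulrC conn_dyC.
Qed.
Lemma berwald_y i j k : \sum_l B i j k l * y l = 0.
Proof.
rewrite -[RHS](euler_conn_dy i j k); apply: eq_bigr => l _.
by rewrite mulrC berwaldC23 berwaldC12.
Qed.

(** The horizontal derivation is locked: otherwise rewriting with the rules of
    subtraction would reach the difference inside it. *)
Fact hdeltaA_key : unit. Proof. exact: tt. Qed.
Definition hdeltaA k f : S :=
  locked_with hdeltaA_key (X k f - \sum_m N m k * Y m f).
Local Notation dH := hdeltaA.

Lemma hdeltaAE k f : dH k f = X k f - \sum_m N m k * Y m f.
Proof. exact: locked_withE. Qed.

Lemma hdelta_der k : derivation (dH k).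
Proof.
split=> a b; rewrite !hdeltaAE.
  rewrite (derD (Xd k)) (eq_bigr _ (fun m _ => congr1 _ (derD (Yd m) _ _))).
  by under eq_bigr do rewrite mulrDr; rewrite big_split /=; ring.
rewrite (derM (Xd k)) (eq_bigr _ (fun m _ => congr1 _ (derM (Yd m) _ _))).
under eq_bigr => m _.
  rewrite (_ : N m k * _ = N m k * Y m a * b + a * (N m k * Y m b)); last by ring.
  over.
by rewrite big_split -mulr_suml -mulr_sumr /=; ring.
Qed.
Let Hd := hdelta_der.

(** The only failure of commutation between vertical and horizontal derivations
    is a term in the connection coefficients; iterating it produces all the
    curvature identities. *)
Lemma dY_hdelta j k f : Y j (dH k f) = dH k (Y j f) - \sum_m Ga m j k * Y m f.
Proof.
rewrite !hdeltaAE (derB (Yd j)) dYXC (der_sumM (Yd j)) -/(Ga _ _ _).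
under [X in _ - (_ + X)]eq_bigr do rewrite dYC.
by rewrite /N /Ga; ring.
Qed.

Lemma hdelta_y k i : dH k (y i) = - N i k.
Proof.
rewrite !hdeltaAE dX_y sub0r; congr (- _).
under eq_bigr do rewrite dY_y eq_sym.
by rewrite (sum_deltar (fun m => N m k)).
Qed.

(** [spray_eq] contracted with y. *)
Lemma y_dX_energy : \sum_k y k * X k L = 4 * \sum_l yl l * G l.
Proof.
have -> : 4 * \sum_l yl l * G l = \sum_i y i * (4 * \sum_l gm i l * G l).
  rewrite mulr_sumr; under [RHS]eq_bigr do rewrite mulrA mulr_sumr.
  rewrite exchange_big; apply: eq_bigr => l _ /=.
  rewrite /yl mulr_suml mulr_sumr; apply: eq_bigr => i _; rewrite metricAC; ring.
under [RHS]eq_bigr do rewrite spray_eq mulrBr mulr_sumr.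
rewrite sumrB exchange_big /= -sumrB; apply: eq_bigr => k _.
transitivity (y k * X k (\sum_i y i * Y i L) - y k * X k L).
  by rewrite energy_euler (der_natl (Xd k)); ring.
congr (_ - _); rewrite (der_sumM (Xd k)).
rewrite [X in _ * (X + _)]big1 ?add0r; last by move=> j _; rewrite dX_y mul0r.
by rewrite mulr_sumr; apply: eq_bigr => i _; ring.
Qed.

(** Horizontal curves preserve F.  Differentiate [y_dX_energy] vertically and
    eliminate the second derivatives of F^2 by [spray_eq]. *)
Lemma hdelta_energy k : dH k L = 0.
Proof.
apply: (@torsion_free _ S 1).
have := congr1 (Y k) y_dX_energy; rewrite (der_sumM (Yd k)).
under eq_bigr do rewrite dY_y; rewrite sum_deltal.
under eq_bigr do rewrite dYXC.
rewrite (der_natl (Yd k)) (der_sumM (Yd k)) -/(N _ _).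
under [X in 4 * (X + _)]eq_bigr do rewrite dY_y_low.
rewrite mulrDr spray_eq.
under [\sum_i y i * _]eq_bigr do rewrite mulrC.
set s := \sum_i _ => /eqP; rewrite addrC -subr_eq0 => /eqP h.
rewrite -[RHS]h hdeltaAE.
under eq_bigr do rewrite dY_energy mulrCA [N _ _ * _]mulrC.
by rewrite -mulr_sumr /N; ring.
Qed.

Lemma hdelta_energyV k : dH k LV = 0.
Proof. exact: (der_inv (Hd k) (energyK S) (hdelta_energy k)). Qed.

(** The covector y_j is parallel: the vertical derivative of [hdelta_energy]. *)
Lemma hdelta_y_low k j : dH k (yl j) = \sum_m Ga m j k * yl m.
Proof.
have := dY_hdelta j k L; rewrite hdelta_energy (der0 (Yd j)) => /esym/eqP.
rewrite subr_eq0 dY_energy (der_natl (Hd k)) => /eqP h.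
rewrite -[LHS]half_double h mulr_sumr; apply: eq_bigr => m _.
by rewrite dY_energy mulrCA half_double.
Qed.

Definition hcov2A (T : 'I_n -> 'I_n -> S) i j k : S :=
  dH k (T i j) - \sum_m T m j * Ga m i k - \sum_m T i m * Ga m j k.
Local Notation hc2 := hcov2A.

Definition hcov3A (T : 'I_n -> 'I_n -> 'I_n -> S) i j k l : S :=
  dH l (T i j k) - \sum_m T m j k * Ga m i l - \sum_m T i m k * Ga m j l
  - \sum_m T i j m * Ga m k l.
Local Notation hc3 := hcov3A.

(** Covariant derivative of a tensor with one upper and three lower indices, the
    type of the Berwald curvature. *)
Definition hcov13 (T : 'I_n -> 'I_n -> 'I_n -> 'I_n -> S) i j k l m : S :=
  dH m (T i j k l) + \sum_r T r j k l * Ga i r m - \sum_r T i r k l * Ga r j m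
  - \sum_r T i j r l * Ga r k m - \sum_r T i j k r * Ga r l m.
Local Notation hc13 := hcov13.

(** The contraction y_m B^m_ijk, which is -2 times the Landsberg curvature
    ([landsbergAE]). *)
Definition berwald_low i j k : S := \sum_m yl m * B m i j k.
Local Notation P := berwald_low.

Lemma berwald_lowC12 i j k : P i j k = P j i k.
Proof. by apply: eq_bigr => m _; rewrite berwaldC12. Qed.
Lemma berwald_lowC23 i j k : P i j k = P i k j.
Proof. by apply: eq_bigr => m _; rewrite berwaldC23. Qed.
Lemma berwald_low_y i j : \sum_k P i j k * y k = 0.
Proof.
rewrite /P; under eq_bigr do rewrite mulr_suml; rewrite exchange_big big1//= => m _.
by under eq_bigr do rewrite -mulrA; rewrite -mulr_sumr berwald_y mulr0.
Qed.

(** The Berwald connection fails to be metric exactly by this tensor; it is the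
    vertical derivative of [hdelta_y_low]. *)
Lemma hcov2_metric i j k : hc2 gm i j k = P i j k.
Proof.
have := congr1 (Y i) (hdelta_y_low k j); rewrite dY_hdelta dY_y_low (der_sumM (Yd i)).
have -> : \sum_m Y i (Ga m j k) * yl m = P i j k.
  by apply: eq_bigr => m _; rewrite mulrC.
move=> h; have -> : P i j k = dH k (gm i j) - \sum_m Ga m i k * Y m (yl j)
   - \sum_m Ga m j k * Y i (yl m) by rewrite h; ring.
rewrite /hc2; congr (_ - _ - _); apply: eq_bigr => m _; by rewrite mulrC dY_y_low.
Qed.

Lemma hcov3Z (c : S) T i j k l : dH l c = 0 ->
  hc3 (fun i j k => c * T i j k) i j k l = c * hc3 T i j k l.
Proof.
move=> cl; rewrite /hc3 (derM (Hd l)) cl mul0r add0r !mulrBr !mulr_sumr.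
by congr (_ - _ - _ - _); apply: eq_bigr => m _; rewrite mulrA.
Qed.

Lemma hcov2Z (c : S) T i j k :
  hc2 (fun i j => c * T i j) i j k = dH k c * T i j + c * hc2 T i j k.
Proof.
rewrite /hc2 (derM (Hd k)) !mulrBr !mulr_sumr !addrA.
by congr (_ - _ - _); apply: eq_bigr => m _; rewrite mulrA.
Qed.

Definition cartanA i j k : S := hf * Y k (gm i j).
Definition landsbergA i j k : S := \sum_s hc3 cartanA i j k s * y s.

(** The vertical derivative of [hcov2_metric]. *)
Lemma hcov3_dY_metric i j k s :
  hc3 (fun i j k => Y k (gm i j)) i j k s =
  Y k (P i j s) + \sum_m gm m j * B m k i s + \sum_m gm i m * B m k j s.
Proof.
rewrite -hcov2_metric /hc2 2!(derB (Yd k)).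
rewrite dY_hdelta !(der_sumM (Yd k)) /hc3.
under [X in _ - X = _]eq_bigr do rewrite mulrC.
rewrite -/(B _ _ _ _); ring.
Qed.

(** Contract [hcov3_dY_metric] with y^s: the terms in B vanish since B is
    annihilated by y, and moving y^s through the vertical derivative of
    P_ijs y^s = 0 leaves -P_ijk. *)
Lemma landsbergAE i j k : landsbergA i j k = - (hf * P i j k).
Proof.
rewrite /landsbergA /cartanA.
under eq_bigr do rewrite (hcov3Z _ _ _ _ (der_half (Hd _))) hcov3_dY_metric -mulrA.
rewrite -mulr_sumr -mulrN; congr (_ * _).
under eq_bigr do rewrite !mulrDl !mulr_suml.
rewrite !big_split /= [X in _ + X + _]exchange_big [X in _ + _ + X]exchange_big /=.
rewrite [X in _ + X + _]big1 ?addr0; last first.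
  by move=> m _; under eq_bigr do rewrite -mulrA; rewrite -mulr_sumr berwald_y mulr0.
rewrite [X in _ + X]big1 ?addr0; last first.
  by move=> m _; under eq_bigr do rewrite -mulrA; rewrite -mulr_sumr berwald_y mulr0.
have := congr1 (Y k) (berwald_low_y i j); rewrite (der_sumM (Yd k)) (der0 (Yd k)).
under [X in _ + X]eq_bigr do rewrite dY_y.
by rewrite (sum_deltar (P i j)) => /eqP; rewrite addr_eq0 => /eqP.
Qed.

Definition stretchA i j k l : S :=
  2 * (hc3 landsbergA i j k l - hc3 landsbergA i j l k).

Lemma stretchAE i j k l : stretchA i j k l = hc3 P i j l k - hc3 P i j k l.
Proof.
have E (a b c d : 'I_n) : hc3 landsbergA a b c d = - hf * hc3 P a b c d.
  rewrite -hcov3Z; last by rewrite (derN (Hd _)) (der_half (Hd _)) oppr0.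
  rewrite /hc3 !landsbergAE; congr (_ - _ - _ - _).
  - by rewrite mulNr.
  - by apply: eq_bigr => m _; rewrite landsbergAE -mulNr.
  - by apply: eq_bigr => m _; rewrite landsbergAE -mulNr.
  - by apply: eq_bigr => m _; rewrite landsbergAE -mulNr.
rewrite /stretchA !E.
transitivity ((2 * hf) * (hc3 P i j l k - hc3 P i j k l)); first by ring.
by rewrite half2 mul1r.
Qed.

Definition nl_curvature i k l : S := dH k (N i l) - dH l (N i k).
Local Notation Om := nl_curvature.
Definition riemannA i k : S :=
  2 * X k (G i) - \sum_j y j * X j (Y k (G i))
  + 2 * (\sum_j G j * Y j (Y k (G i))) - \sum_j Y j (G i) * Y k (G j).
Local Notation riem := riemannA.

Lemma curvatureC i k l : Om i l k = - Om i k l.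
Proof. by rewrite /Om opprB. Qed.

Lemma dY_curvature i j k l : Y j (Om i k l) =
  (dH k (Ga i j l) - dH l (Ga i j k))
  - (\sum_m Ga m j k * Ga i m l - \sum_m Ga m j l * Ga i m k).
Proof. by rewrite /Om (derB (Yd j)) !dY_hdelta /N /Ga; ring. Qed.

(** By [dY_curvature] the terms cancel in pairs, the connection coefficients being
    symmetric. *)
Lemma bianchi_cyclic i j k l : Y j (Om i k l) + Y k (Om i l j) + Y l (Om i j k) = 0.
Proof.
rewrite !dY_curvature ![Ga i l _]conn_dyC ![Ga i k j]conn_dyC.
have e (a b c : 'I_n) : \sum_m Ga m a b * Ga i m c = \sum_m Ga m b a * Ga i m c.
  by apply: eq_bigr => m _; rewrite conn_dyC.
by rewrite (e l k) (e l j) (e k j); ring.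
Qed.

Lemma berwald_rot i j k l : B i j k l = B i k l j.
Proof. by rewrite berwaldC12 berwaldC23. Qed.

Lemma dY_hdelta_conn_dy i j k l m : Y m (dH k (Ga i j l)) =
  dH k (B i j l m) - \sum_r B i j l r * Ga r m k.
Proof.
rewrite dY_hdelta -/(B _ _ _ _) berwald_rot; congr (_ - _).
by apply: eq_bigr => r _; rewrite mulrC -/(B _ _ _ _) berwald_rot.
Qed.

(** The second vertical derivatives of the curvature only see the Berwald
    curvature: those of d_k N^i_l are d_k B^i_jlm plus correction terms, and
    the corrections are the ones of the covariant derivative. *)
Lemma dYdY_curvature i j k l m :
  Y m (Y j (Om i k l)) = hc13 B i j l m k - hc13 B i j k m l.
Proof.
rewrite dY_curvature 2!(derB (Yd m)) !dY_hdelta_conn_dy.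
rewrite (derB (Yd m)) !(der_sumM (Yd m)) /hc13.
have s1 k' l' : \sum_r Y m (Ga r j k') * Ga i r l' = \sum_r B r j k' m * Ga i r l'.
  by apply: eq_bigr => r _; rewrite -/(B _ _ _ _) berwald_rot.
have s2 k' l' : \sum_r Ga r j k' * Y m (Ga i r l') = \sum_r B i r l' m * Ga r j k'.
  by apply: eq_bigr => r _; rewrite mulrC -/(B _ _ _ _) berwald_rot.
have s3 : \sum_r B i j r m * Ga r l k = \sum_r B i j r m * Ga r k l.
  by apply: eq_bigr => r _; rewrite conn_dyC.
by rewrite !s1 !s2 s3; ring.
Qed.

(** Move y^l through the horizontal derivations: N^i_l y^l = 2 G^i, and the
    horizontal derivative of y^l is -N^l_k. *)
Lemma riemannAE i k : riem i k = \sum_l Om i k l * y l.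
Proof.
rewrite /Om; under eq_bigr do rewrite mulrBl; rewrite sumrB.
have -> : \sum_l dH k (N i l) * y l = 2 * dH k (G i) + \sum_l N i l * N l k.
  have := congr1 (dH k) (conn_y i); rewrite (der_sumM (Hd k)) (der_natl (Hd k)).
  move=> <-; rewrite -addrA -big_split /= [X in _ = _ + X]big1 ?addr0// => l _.
  by rewrite hdelta_y; ring.
have -> : \sum_l dH l (N i k) * y l =
    \sum_l y l * X l (N i k) - 2 * \sum_m G m * Y m (N i k).
  under [LHS]eq_bigr do rewrite hdeltaAE.
  under eq_bigr do rewrite mulrBl; rewrite sumrB.
  congr (_ - _); first by apply: eq_bigr => l _; rewrite mulrC.
  under eq_bigr do rewrite mulr_suml; rewrite exchange_big /= mulr_sumr.
  apply: eq_bigr => m _; rewrite mulrA -conn_y mulr_suml.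
  by apply: eq_bigr => l _; rewrite mulrAC.
rewrite /riem hdeltaAE /N.
under [\sum_m Y k (G m) * _]eq_bigr do rewrite mulrC.
by ring.
Qed.

Lemma euler_hdelta k f : Eu (dH k f) = dH k (Eu f).
Proof.
rewrite !hdeltaAE (derB euler_der) euler_dX (der_sumM euler_der); congr (_ - _).
rewrite -big_split; apply: eq_bigr => m _ /=.
by rewrite euler_conn euler_dY; ring.
Qed.

Lemma euler_curvature i k l : Eu (Om i k l) = Om i k l.
Proof. by rewrite /Om (derB euler_der) !euler_hdelta !euler_conn. Qed.

Lemma dY_curvature_y i k l : \sum_j Y j (Om i k l) * y j = Om i k l.
Proof. by rewrite -[RHS]euler_curvature; apply: eq_bigr => j _; rewrite mulrC. Qed.

Lemma dY_riemann i k m :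
  Y m (riem i k) = \sum_l Y m (Om i k l) * y l + Om i k m.
Proof.
rewrite riemannAE (der_sumM (Yd m)).
under [X in _ + X]eq_bigr do rewrite dY_y.
by rewrite (sum_deltar (Om i k)).
Qed.

(** By [riemannAE] the left side is 2 W^i_km plus a curl of W contracted with y;
    [bianchi_cyclic] and the homogeneity of W turn the latter into a third copy
    of W^i_km. *)
Lemma riemann_curl i k m : Y m (riem i k) - Y k (riem i m) = 3 * Om i k m.
Proof.
have -> : Y m (riem i k) - Y k (riem i m) =
    \sum_l (Y m (Om i k l) - Y k (Om i m l)) * y l + (Om i k m - Om i m k).
  rewrite !dY_riemann; under [in RHS]eq_bigr do rewrite mulrBl.
  by rewrite sumrB; ring.
rewrite (curvatureC i k m) -[in LHS](dY_curvature_y i k m).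
have -> : \sum_l (Y m (Om i k l) - Y k (Om i m l)) * y l =
    \sum_l Y l (Om i k m) * y l.
  apply: eq_bigr => l _; congr (_ * _).
  have := bianchi_cyclic i m k l.
  rewrite (curvatureC i m l) (curvatureC i k m) !(derN (Yd _)) => /eqP.
  by rewrite subr_eq0 => /eqP.
by rewrite dY_curvature_y; ring.
Qed.

(** The coefficients of this formula in y are constant on fibres as soon as W is
    linear in y; see [fiber_quadratic]. *)
Lemma riemann_quadratic i k :
  riem i k = \sum_j \sum_l Y j (Om i k l) * y j * y l.
Proof.
rewrite riemannAE exchange_big; apply: eq_bigr => l _ /=.
by rewrite -mulr_suml dY_curvature_y.
Qed.

Lemma curvature_linear_of_riemann :
  (forall a b c i k, Y a (Y b (Y c (riem i k))) = 0) ->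
  forall a b i k l, Y a (Y b (Om i k l)) = 0.
Proof.
move=> R3 a b i k l; apply: (@torsion_free _ S 2).
rewrite -(der_natl (Yd a)) -(der_natl (Yd b)) -riemann_curl.
by rewrite (derB (Yd b)) (derB (Yd a)) !R3 subrr.
Qed.

Lemma curvature_linear_iff :
  (forall a b i k l, Y a (Y b (Om i k l)) = 0) <->
  (forall i j k l m, hc13 B i j k l m = hc13 B i j k m l).
Proof.
(* B is symmetric in its lower indices, and so is its covariant derivative. *)
have sw i j k l m : hc13 B i j l m k = hc13 B i j m l k.
  rewrite /hc13 berwaldC23; under [X in _ + X - _ - _ - _]eq_bigr do rewrite berwaldC23.
  under [X in _ + _ - X - _ - _]eq_bigr do rewrite berwaldC23.
  under [X in _ + _ - _ - X - _]eq_bigr do rewrite berwaldC23.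
  under [X in _ + _ - _ - _ - X]eq_bigr do rewrite berwaldC23.
  by ring.
split=> h.
  move=> i j k l m; apply/eqP; rewrite -subr_eq0 -(h k j i m l) dYdY_curvature.
  by rewrite (sw i j m k l) (sw i j l k m).
by move=> a b i k l; rewrite dYdY_curvature (sw i b k l a) (sw i b l k a) h subrr.
Qed.

(** * The angular metric and covariant derivatives of products *)

Definition angularA i j : S := gm i j - yl i * yl j * LV.
Local Notation ha := angularA.
Definition angular_mixedA i j : S := (i == j)%:R - y i * yl j * LV.
Local Notation hm := angular_mixedA.

Lemma angularAC i j : ha i j = ha j i.
Proof. by rewrite /ha metricAC [yl i * _]mulrC. Qed.

Lemma y_low_angular_mixed j : \sum_i yl i * hm i j = 0.
Proof.
rewrite /hm; under eq_bigr do rewrite mulrBr; rewrite sumrB.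
under [X in X - _]eq_bigr do rewrite eq_sym.
rewrite (sum_deltar yl).
transitivity (yl j - (\sum_i y i * yl i) * (yl j * LV)).
  by congr (_ - _); rewrite mulr_suml; apply: eq_bigr => i _; ring.
rewrite y_y_low; transitivity (yl j * (1 - L * LV)); first by ring.
by rewrite energyK subrr mulr0.
Qed.

Lemma angular_y i : \sum_j ha i j * y j = 0.
Proof.
rewrite /ha; under eq_bigr do rewrite mulrBl; rewrite sumrB -/(yl i).
transitivity (yl i - (yl i * LV) * (\sum_j y j * yl j)).
  by congr (_ - _); rewrite mulr_sumr; apply: eq_bigr => j _; ring.
rewrite y_y_low; transitivity (yl i * (1 - L * LV)); first by ring.
by rewrite energyK subrr mulr0.
Qed.

Lemma angular_mixed_trace : \sum_i hm i i = n%:R - 1.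
Proof.
rewrite /hm sumrB; congr (_ - _).
  under eq_bigr do rewrite eqxx.
  by rewrite sumr_const card_ord.
by rewrite -mulr_suml y_y_low energyK.
Qed.

(** h^i_j is the identity on covectors annihilated by y. *)
Lemma angular_mixed_contract (v : 'I_n -> S) : \sum_m v m * y m = 0 ->
  forall j, \sum_m hm m j * v m = v j.
Proof.
move=> vy j; rewrite /hm; under eq_bigr do rewrite mulrBl; rewrite sumrB.
under eq_bigr do rewrite eq_sym; rewrite sum_deltal.
rewrite [X in _ - X](_ : _ = (yl j * LV) * \sum_m v m * y m).
  by rewrite vy mulr0 subr0.
by rewrite mulr_sumr; apply: eq_bigr => m _; ring.
Qed.

Lemma y_low_ginv k : \sum_l yl l * gi l k = y k.
Proof.
rewrite /yl; under eq_bigr do rewrite mulr_suml.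
rewrite exchange_big /= -[RHS](sum_deltar y k); apply: eq_bigr => j _.
rewrite [k == j]eq_sym -ginvK mulr_sumr; apply: eq_bigr => l _.
by rewrite metricAC; ring.
Qed.

Lemma angular_ginv i k : \sum_l ha i l * gi l k = hm k i.
Proof.
rewrite /ha; under eq_bigr do rewrite mulrBl; rewrite sumrB ginvK eq_sym.
rewrite /hm -y_low_ginv; congr (_ - _); rewrite -mulrA mulr_suml.
by apply: eq_bigr => l _; ring.
Qed.

Definition hcov_vec (U : 'I_n -> S) i m : S := dH m (U i) + \sum_r U r * Ga i r m.
Definition hcov11 (U : 'I_n -> 'I_n -> S) i j m : S :=
  dH m (U i j) + \sum_r U r j * Ga i r m - \sum_r U i r * Ga r j m.

Lemma hcov_vec_y i m : hcov_vec y i m = 0.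
Proof.
rewrite /hcov_vec hdelta_y -conn_dy_y addrC.
under eq_bigr do rewrite mulrC conn_dyC.
by rewrite subrr.
Qed.

(** The projector h^i_j is built from the parallel objects y^i, y_j and F^2. *)
Lemma hcov11_angular_mixed i j m : hcov11 hm i j m = 0.
Proof.
have h : dH m (y i) = - \sum_r y r * Ga i r m.
  by have /eqP := hcov_vec_y i m; rewrite addr_eq0 => /eqP.
rewrite /hcov11 /hm (derB (Hd m)) (der_bool (Hd m)) !(derM (Hd m)).
rewrite hdelta_energyV hdelta_y_low h.
under [X in _ + X - _]eq_bigr do rewrite mulrBl.
under [X in _ + _ - X]eq_bigr do rewrite mulrBl.
rewrite !sumrB sum_deltal.
under [X in _ + (X - _) - _]eq_bigr do rewrite eq_sym.
rewrite sum_deltal.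
have -> : \sum_r y r * yl j * LV * Ga i r m =
    (\sum_r y r * Ga i r m) * yl j * LV.
  by rewrite !mulr_suml; apply: eq_bigr => r _; ring.
have -> : \sum_r y i * yl r * LV * Ga r j m =
    (\sum_r Ga r j m * yl r) * y i * LV.
  by rewrite !mulr_suml; apply: eq_bigr => r _; ring.
by ring.
Qed.

(** As y_i and F^2 are parallel, only the metric contributes. *)
Lemma hcov2_angular i j k : hc2 ha i j k = P i j k.
Proof.
rewrite -hcov2_metric /hc2 /ha (derB (Hd k)) !(derM (Hd k)).
rewrite hdelta_energyV !hdelta_y_low.
under [X in _ - X - _ = _]eq_bigr do rewrite mulrBl.
under [X in _ - _ - X = _]eq_bigr do rewrite mulrBl.
rewrite !sumrB.
have -> : \sum_m yl m * yl j * LV * Ga m i k =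
    (\sum_m Ga m i k * yl m) * yl j * LV.
  by rewrite !mulr_suml; apply: eq_bigr => r _; ring.
have -> : \sum_m yl i * yl m * LV * Ga m j k =
    (\sum_m Ga m j k * yl m) * yl i * LV.
  by rewrite !mulr_suml; apply: eq_bigr => r _; ring.
by ring.
Qed.

Lemma hcov13_ext T T' i j k l m :
  (forall i j k l, T i j k l = T' i j k l) ->
  hc13 T i j k l m = hc13 T' i j k l m.
Proof.
move=> e; rewrite /hc13 e; congr (_ + _ - _ - _ - _);
  by apply: eq_bigr => r _; rewrite e.
Qed.

Lemma hcov13D T T' i j k l m :
  hc13 (fun i j k l => T i j k l + T' i j k l) i j k l m =
  hc13 T i j k l m + hc13 T' i j k l m.
Proof.
rewrite /hc13 (derD (Hd m)).
do !under [\sum_r (_ + _) * _]eq_bigr do rewrite mulrDl.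
by rewrite !big_split /=; ring.
Qed.

Lemma hcov13Z (c : S) T i j k l m :
  hc13 (fun i j k l => c * T i j k l) i j k l m =
  dH m c * T i j k l + c * hc13 T i j k l m.
Proof.
rewrite /hc13 (derM (Hd m)).
do !under [\sum_r (c * _) * _]eq_bigr do rewrite -mulrA.
by rewrite -!mulr_sumr; ring.
Qed.

Lemma hcov13_vec U V i j k l m :
  hc13 (fun i j k l => V j k l * U i) i j k l m =
  hc3 V j k l m * U i + V j k l * hcov_vec U i m.
Proof.
rewrite /hc13 /hc3 /hcov_vec (derM (Hd m)).
under [\sum_r V j k l * U r * _]eq_bigr do rewrite -mulrA.
under [\sum_r V r k l * U i * _]eq_bigr do rewrite mulrAC.
under [\sum_r V j r l * U i * _]eq_bigr do rewrite mulrAC.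
under [\sum_r V j k r * U i * _]eq_bigr do rewrite mulrAC.
by rewrite -!mulr_suml -mulr_sumr; ring.
Qed.

Lemma hcov13_prod U V i j k l m :
  hc13 (fun i j k l => U i j * V k l) i j k l m =
  hcov11 U i j m * V k l + U i j * hc2 V k l m.
Proof.
rewrite /hc13 /hcov11 /hc2 (derM (Hd m)).
under [\sum_r U r j * V k l * _]eq_bigr do rewrite mulrAC.
under [\sum_r U i r * V k l * _]eq_bigr do rewrite mulrAC.
under [\sum_r U i j * V r l * _]eq_bigr do rewrite -mulrA.
under [\sum_r U i j * V k r * _]eq_bigr do rewrite -mulrA.
by rewrite -!mulr_suml -!mulr_sumr; ring.
Qed.

Lemma hcov13_swap T i j k l m :
  hc13 (fun i j k l => T i k j l) i j k l m = hc13 T i k j l m.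
Proof. by rewrite /hc13; ring. Qed.

Lemma hcov13_rot T i j k l m :
  hc13 (fun i j k l => T i l j k) i j k l m = hc13 T i l j k m.
Proof. by rewrite /hc13; ring. Qed.

(** The symmetrised product which multiplies lambda in the isotropy condition. *)
Definition angular_sum i j k l : S :=
  hm i j * ha k l + hm i k * ha j l + hm i l * ha j k.

Lemma y_low_angular_sum j k l : \sum_i yl i * angular_sum i j k l = 0.
Proof.
rewrite /angular_sum; under eq_bigr do rewrite !mulrDr !mulrA.
by rewrite !big_split /= -!mulr_suml !y_low_angular_mixed !mul0r !addr0.
Qed.

Lemma angular_sum_trace j k : \sum_m angular_sum m j k m = (n%:R + 1) * ha j k.
Proof.
rewrite /angular_sum !big_split /= -mulr_suml angular_mixed_trace.
rewrite (angular_mixed_contract (angular_y k)).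
rewrite (angular_mixed_contract (angular_y j)) [ha k j]angularAC.
by ring.
Qed.

(** * Isotropic Berwald curvature *)

(** The isotropy condition with mu eliminated: contracting it with y_i gives
    P_jkl = mu C_jkl F. *)
Definition isotropic (lam : S) : Prop := forall i j k l,
  B i j k l = LV * (P j k l * y i) + lam * angular_sum i j k l.

Definition mean_berwaldA j k : S := hf * \sum_m B m j k m.

Section Isotropic.
Variable lam : S.
Hypothesis iso : isotropic lam.

Lemma berwald_trace j k : \sum_m B m j k m = lam * ((n%:R + 1) * ha j k).
Proof.
under eq_bigr do rewrite iso.
rewrite big_split /= -!mulr_sumr berwald_low_y mulr0 add0r.
by rewrite angular_sum_trace.
Qed.

(** Only P, lambda and the lowered angular metric have a covariant derivative;
    the rest of the isotropic expression is parallel. *)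
Lemma hcov13_berwald i j k l m :
  hc13 B i j k l m = LV * (hc3 P j k l m * y i) +
    (dH m lam * (hm i j * ha k l + hm i k * ha j l + hm i l * ha j k) +
     lam * (hm i j * P k l m + hm i k * P j l m + hm i l * P j k m)).
Proof.
pose T i j k l := hm i j * ha k l.
rewrite (hcov13_ext (T' := fun i j k l => LV * (P j k l * y i) +
   lam * (T i j k l + T i k j l + T i l j k))); last exact: iso.
rewrite hcov13D !hcov13Z hdelta_energyV mul0r add0r !hcov13D.
rewrite (hcov13_swap T) (hcov13_rot T).
rewrite (hcov13_vec y P) hcov_vec_y mulr0 addr0 !hcov13_prod.
rewrite !hcov11_angular_mixed !hcov2_angular /T.
by ring.
Qed.

Definition mean_berwald_barA j k l : S := hc2 mean_berwaldA j k l.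

Lemma natmul_inj (p : nat) f : (0 < p)%N -> p%:R * f = 0 -> f = 0.
Proof. by case: p => // p _; exact: torsion_free. Qed.

(** The mean Berwald curvature is (n + 1) lambda h_jk / 2, by the trace of the
    isotropy condition. *)
Lemma mean_berwald_bar_eq0 j k l : mean_berwald_barA j k l = 0 <->
  dH l lam * ha j k + lam * P j k l = 0.
Proof.
have -> : mean_berwald_barA j k l =
    hf * (n.+1%:R * (dH l lam * ha j k + lam * P j k l)).
  pose c : S := hf * n.+1%:R * lam.
  have e a b : mean_berwaldA a b = c * ha a b.
    by rewrite /mean_berwaldA berwald_trace /c -natr1; ring.
  have -> : mean_berwald_barA j k l = hc2 (fun a b => c * ha a b) j k l.
    by rewrite /mean_berwald_barA /hc2 e; congr (_ - _ - _); apply: eq_bigr => m _;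
      rewrite e.
  rewrite hcov2Z hcov2_angular.
  rewrite /c -mulrA (derM (Hd l)) (der_half (Hd l)) (der_natl (Hd l)).
  by ring.
split=> [h|->]; last by rewrite !mulr0.
apply: (@natmul_inj n.+1) => //.
by rewrite -[LHS]half_double mulrCA h mulr0.
Qed.

Hypothesis n_gt2 : (2 < n)%N.

Lemma natr_pred (p : nat) : (0 < p)%N -> p.-1%:R = p%:R - 1 :> S.
Proof. by case: p => // p _; rewrite -natr1 addrK. Qed.

Lemma mul_pred f : (n%:R - 1) * f = 0 -> f = 0.
Proof.
have n_gt0 : (0 < n)%N by exact: leq_trans n_gt2.
by rewrite -natr_pred// => /natmul_inj; apply; rewrite -subn1 subn_gt0 ltnW.
Qed.

(** This is where dimension 2 is excluded: (n - 1) f = f means (n - 2) f = 0. *)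
Lemma mul_pred_id f : (n%:R - 1) * f = f -> f = 0.
Proof.
have n_gt0 : (0 < n)%N by exact: leq_trans n_gt2.
have n1_gt0 : (0 < n.-1)%N by rewrite -subn1 subn_gt0 ltnW.
move=> h; apply: (@natmul_inj n.-2); first by rewrite -subn2 subn_gt0.
by rewrite !natr_pred// mulrBl h mul1r subrr.
Qed.

Lemma angular_trace : \sum_k \sum_l ha k l * gi l k = n%:R - 1.
Proof. by rewrite -angular_mixed_trace; apply: eq_bigr => k _; rewrite angular_ginv. Qed.

(** Contract with y^m, then trace: lambda_|m y^m = 0.  Trace the hypothesis over
    k and l: the right side becomes h^l_m lambda_|l = lambda_|m by the first
    step, so (n - 1) lambda_|m = lambda_|m. *)
Lemma horizontally_constant :
  (forall k l m, dH m lam * ha k l = dH l lam * ha k m) ->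
  forall m, dH m lam = 0.
Proof.
move=> h m.
have vy : \sum_l dH l lam * y l = 0.
  apply: mul_pred; rewrite -angular_trace mulr_suml big1// => k _.
  rewrite mulr_suml big1// => l _.
  rewrite mulrC mulrA mulr_suml; under eq_bigr do rewrite mulrAC h -mulrA.
  by rewrite -mulr_sumr angular_y mulr0 mul0r.
apply: mul_pred_id; rewrite -angular_trace -[RHS](angular_mixed_contract vy).
rewrite mulr_suml; under eq_bigr do rewrite mulr_suml.
rewrite exchange_big; apply: eq_bigr => l _ /=.
rewrite -angular_ginv mulr_suml; apply: eq_bigr => k _.
by rewrite mulrAC [ha k l * _]mulrC h ginvC angularAC; ring.
Qed.

Lemma berwald_low_rot j k l : P j k l = P k l j.
Proof. by rewrite berwald_lowC12 berwald_lowC23. Qed.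

(** The tensor analysis of the theorem: compare the two sides of the symmetry
    through [hcov13_berwald], contracting with y_i and tracing. *)
Lemma isotropic_symmetry_iff :
  (forall i j k l m, hc13 B i j k l m = hc13 B i j k m l) <->
  (forall j k l m, hc3 P j k l m = hc3 P j k m l) /\
  (forall j k l, dH l lam * ha j k + lam * P j k l = 0).
Proof.
split=> [D|[st e]]; last first.
  have lam0 : forall m, dH m lam = 0.
    apply: horizontally_constant => k l m.
    have /eqP := e k l m; rewrite addr_eq0 => /eqP ->.
    have /eqP := e k m l; rewrite addr_eq0 => /eqP ->.
    by rewrite berwald_lowC23.
  have lamP a b c : lam * P a b c = 0 by rewrite -[RHS](e a b c) lam0 mul0r add0r.
  move=> i j k l m; rewrite !hcov13_berwald st !lam0 !mul0r !mulrDr.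
  by rewrite ![lam * (_ * _)]mulrCA !lamP !mulr0.
have st j k l m : hc3 P j k l m = hc3 P j k m l.
  have c a b : \sum_i yl i * hc13 B i j k a b = hc3 P j k a b.
    under eq_bigr => i _.
      rewrite hcov13_berwald (_ : _ * _ = (LV * hc3 P j k a b) * (y i * yl i) +
        (dH b lam * ha k a + lam * P k a b) * (yl i * hm i j) +
        (dH b lam * ha j a + lam * P j a b) * (yl i * hm i k) +
        (dH b lam * ha j k + lam * P j k b) * (yl i * hm i a)); last by ring.
      over.
    rewrite !big_split /= -!mulr_sumr !y_low_angular_mixed !mulr0 !addr0 y_y_low.
    by rewrite mulrAC [LV * L]mulrC energyK mul1r.
  by rewrite -!c; apply: eq_bigr => i _; rewrite D.
split=> // j k l.
have D' a b c d e : dH e lam * (hm a b * ha c d + hm a c * ha b d + hm a d * ha b c) +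
     lam * (hm a b * P c d e + hm a c * P b d e + hm a d * P b c e) =
     dH d lam * (hm a b * ha c e + hm a c * ha b e + hm a e * ha b c) +
     lam * (hm a b * P c e d + hm a c * P b e d + hm a e * P b c d).
  by have := D a b c d e; rewrite !hcov13_berwald st => /addrI.
have lam0 : forall m, dH m lam = 0.
  apply: horizontally_constant => c d e.
  apply/eqP; rewrite -subr_eq0; apply/eqP; apply: (@natmul_inj n.+1) => //.
  (* The trace over the upper and the first lower index, whose coefficient
     n + 1 is (n - 1) + 2. *)
  have tr d' e' : \sum_a (dH e' lam *
      (hm a a * ha c d' + hm a c * ha a d' + hm a d' * ha a c) +
     lam * (hm a a * P c d' e' + hm a c * P a d' e' + hm a d' * P a c e')) =
     n.+1%:R * (dH e' lam * ha c d') + lam * (n.+1%:R * P c d' e').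
    rewrite big_split /= -!mulr_sumr !big_split /= -!mulr_suml angular_mixed_trace.
    under [\sum_i _ * P i d' e']eq_bigr do rewrite berwald_low_rot.
    under [\sum_i _ * P i c e']eq_bigr do rewrite berwald_low_rot.
    under [\sum_i hm i c * ha i d']eq_bigr do rewrite angularAC.
    under [\sum_i hm i d' * ha i c]eq_bigr do rewrite angularAC.
    rewrite !(angular_mixed_contract (berwald_low_y _ _)).
    rewrite !(angular_mixed_contract (angular_y _)).
    rewrite -natr1 [ha d' c]angularAC -[P d' e' c]berwald_low_rot.
    have -> : P c e' d' = P c d' e' by rewrite berwald_lowC23.
    by ring.
  have := tr d e; under eq_bigr do rewrite D'.
  rewrite tr [P c e d]berwald_lowC23 => /addIr h.
  by rewrite mulrBr h subrr.
rewrite lam0 mul0r add0r.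
apply: mul_pred_id.
have h a b c d e : lam * (hm a d * P b c e) = lam * (hm a e * P b c d).
  have := D' a b c d e; rewrite !lam0 !mul0r !add0r.
  rewrite [P c e d]berwald_lowC23 [P b e d]berwald_lowC23.
  by rewrite !mulrDr => /addrI.
(* Trace over the upper and the third lower index. *)
rewrite -angular_mixed_trace mulr_suml; under eq_bigr do rewrite mulrCA h.
by rewrite -mulr_sumr (angular_mixed_contract (berwald_low_y _ _)).
Qed.

Theorem isotropic_curvature_iff :
  (forall a b i k l, Y a (Y b (Om i k l)) = 0) <->
  (forall i j k l, stretchA i j k l = 0) /\
  (forall j k l, mean_berwald_barA j k l = 0).
Proof.
rewrite curvature_linear_iff isotropic_symmetry_iff; split=> -[st e]; split.
- by move=> i j k l; rewrite stretchAE st subrr.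
- by move=> j k l; apply/mean_berwald_bar_eq0.
- by move=> j k l m; have /eqP := st j k m l; rewrite stretchAE subr_eq0 => /eqP.
- by move=> j k l; apply/mean_berwald_bar_eq0.
Qed.
End Isotropic.
End FinslerRing.

(** * Symmetry of second derivatives *)

Lemma increment_estimate (R : realFieldType) (a b c p q e h : R) : 0 < h ->
  `|b - c - (p + h * q)| <= e / 2 * h -> `|a - c - p| <= e / 2 * h ->
  `|(b - a) * h - h ^+ 2 * q| <= e * h ^+ 2.
Proof.
move=> h0; have -> : (b - a) * h - h ^+ 2 * q = h * (b - a - h * q) by ring.
have -> : e * h ^+ 2 = h * (e * h) by ring.
rewrite !ler_norml => /andP[a1 a2] /andP[b1 b2].
by rewrite -mulrN !ler_pM2l//; lra.
Qed.

Lemma quadratic_coef_close (R : realFieldType) (s a b e h : R) : 0 < h ->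
  `|s - h ^+ 2 * a| <= e / 2 * h ^+ 2 -> `|s - h ^+ 2 * b| <= e / 2 * h ^+ 2 ->
  `|a - b| <= e.
Proof.
move=> h0; have h2 : 0 < h ^+ 2 by rewrite exprn_gt0.
rewrite !ler_norml => /andP[a1 a2] /andP[b1 b2].
suff : h ^+ 2 * - e <= h ^+ 2 * (a - b) <= h ^+ 2 * e by rewrite !ler_pM2l.
by rewrite mulrBr mulrN; lra.
Qed.

Section Calculus.
Variables (R : realType) (V : normedModType R).
Implicit Types (f g : V -> R) (U : set V) (v w x z : V).

(** Differentiability is a local property.  The differential is a chosen linear
    map, so the one of f is exhibited as a witness for g. *)
Lemma near_eq_differentiable f g x :
  (\near x, f x = g x) -> differentiable f x -> differentiable g x.
Proof.
move=> fg df; apply/diffP => /=.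
apply: (@getPex _ (fun (df : {linear V -> R}) => continuous df /\
  forall y, g y = g (lim (nbhs x)) + df (y - lim (nbhs x))
                  +o_(y \near x) (y - lim (nbhs x)))).
have [dfc dfx] := (diffP _ f).1 df.
exists ('d f x); split => //.
have H (e : R) : 0 < e -> \forall y \near x,
    `|f y - (f (lim (nbhs x)) + 'd f x (y - lim (nbhs x)))| <=
      e * `|y - lim (nbhs x)|.
  exact: (eqadd_some_oP (funext dfx)).
have fgx : f x = g x by exact: nbhs_singleton fg.
apply/funeqP; apply/eqaddoP => e e0; have := H e e0; rewrite lim_id// fgx.
by apply: filterS2 fg => y /= ->.
Qed.

Lemma diff_eps f x (e : R) : differentiable f x -> 0 < e ->
  \forall h \near (0 : V), `|f (h + x) - f x - 'd f x h| <= e * `|h|.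
Proof.
move=> /diff_locallyxP[_ dfx] e0.
have H : \forall h \near (0 : V), `|f (h + x) - (f x + 'd f x h)| <= e * `|h|.
  exact: (eqadd_some_oP (funext dfx)).
by apply: filterS H => h /=; rewrite opprD addrA.
Qed.

Lemma is_derive_line f v p (s : R) : differentiable f (s *: v + p) ->
  is_derive s 1 (fun t : R => f (t *: v + p)) ('D_v f (s *: v + p)).
Proof.
move=> df.
have E : (fun h : R => h^-1 *: (f ((h *: 1 + s) *: v + p) - f (s *: v + p))) =
    (fun h : R => h^-1 *: (f (h *: v + (s *: v + p)) - f (s *: v + p))).
  by apply/funext => h; rewrite scalerDl [h *: 1]mulr1 addrA.
apply: DeriveDef.
  by rewrite /derivable E; exact: diff_derivable.
by rewrite /derive E.
Qed.

Lemma mvt_line f v p (h : R) : 0 < h ->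
  (forall s, 0 <= s <= h -> differentiable f (s *: v + p)) ->
  exists2 s, 0 <= s <= h &
    f (h *: v + p) - f p = h * 'D_v f (s *: v + p).
Proof.
move=> h0 df.
have D s : s \in `]0, h[%R ->
    is_derive s 1 (fun t : R => f (t *: v + p)) ('D_v f (s *: v + p)).
  rewrite in_itv/= => /andP[s0 sh].
  by apply: is_derive_line; apply: df; rewrite !ltW.
have C : {within `[0, h], continuous (fun t : R => f (t *: v + p))}.
  apply: derivable_within_continuous => s; rewrite in_itv/= => sh.
  by have [] := is_derive_line (df s sh).
have [s] := MVT h0 D C.
rewrite in_itv/= => /andP[s0 sh].
rewrite scale0r add0r subr0 mulrC => e; exists s => //.
by rewrite !ltW.
Qed.

(** Symmetric in v and w, which is why its asymptotics determine both mixed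
    second derivatives ([derive_comm]). *)
Definition second_difference f z v w (h : R) : R :=
  f (h *: v + (h *: w + z)) - f (h *: w + z) - (f (h *: v + z) - f z).

Lemma second_differenceC f z v w h :
  second_difference f z v w h = second_difference f z w v h.
Proof. by rewrite /second_difference [h *: v + _]addrCA; ring. Qed.

(** View the second difference as the increment of
    t -> f (t v + h w + z) - f (t v + z) on [0, h].  By the mean value theorem it
    is h times an increment of D_v f, and one differential of D_v f at z
    evaluates that increment up to o(h). *)
Lemma second_difference_approx f U z v w (e : R) : open U -> U z ->
  (forall x, U x -> differentiable f x) -> differentiable ('D_v f) z -> 0 < e ->
  \forall h \near 0^'+,
    `|second_difference f z v w h - h ^+ 2 * 'D_w ('D_v f) z| <= e * h ^+ 2.
Proof.
move=> Uo Uz df dg e0; set g := 'D_v f.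
(* All points met below lie within h * C of z. *)
pose C : R := `|v| + `|w| + 1.
have C0 : 0 < C by rewrite /C ltr_wpDl// addr_ge0.
have e1 : 0 < e / (2 * C) by rewrite divr_gt0// mulr_gt0.
have Uz0 : \forall k \near (0 : V), U (k + z).
  have : \near z, U z by exact: open_nbhs_nbhs.
  by rewrite (near_shift 0 z); apply: filterS => k /=; rewrite subr0.
have /nbhs_ballP[d /= d0 Hd] : \forall k \near (0 : V), U (k + z) /\
    `|g (k + z) - g z - 'd g z k| <= e / (2 * C) * `|k|.
  by apply: filterI => //; exact: diff_eps.
near=> h.
have h0 : 0 < h by [].
have hC : h * C < d.
  by rewrite -ltr_pdivlMr//; near: h; apply: nbhs_right_lt; rewrite divr_gt0.
(* The boolean selects one of the two ends s v + h w and s v. *)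
have small (s : R) (b : bool) : 0 <= s <= h ->
    `|s *: v + h *: (w *+ b)| <= h * C.
  move=> /andP[s0 sh]; rewrite (le_trans (ler_normD _ _))// !normrZ.
  rewrite !ger0_norm ?(ltW h0)// /C !mulrDr mulr1.
  rewrite -[leLHS]addr0 lerD ?(ltW h0)// lerD ?ler_wpM2r// ler_wpM2l ?(ltW h0)//.
  by case: b; rewrite ?mulr1n// mulr0n normr0.
have Hk (s : R) (b : bool) : 0 <= s <= h ->
    let k := s *: v + h *: (w *+ b) in
    U (k + z) /\ `|g (k + z) - g z - 'd g z k| <= e / 2 * h.
  move=> /(small _ b) ks k; have [] := Hd k.
    by rewrite -ball_normE/= add0r normrN (le_lt_trans ks).
  move=> ? H; split => //; apply: (le_trans H).
  apply: (le_trans (ler_wpM2l (ltW e1) ks)).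
  have -> : e / (2 * C) * (h * C) = e / 2 * h by field; rewrite gt_eqF.
  by [].
have dfs s (b : bool) : 0 <= s <= h ->
    differentiable f (s *: v + (h *: (w *+ b) + z)).
  by move=> sh; apply: df; have [] := Hk s b sh; rewrite -addrA.
pose phi (t : R) := f (t *: v + (h *: w + z)) - f (t *: v + z).
have Dphi s : 0 <= s <= h ->
    is_derive s 1 phi (g (s *: v + (h *: w + z)) - g (s *: v + z)).
  move=> sh; apply: is_deriveB; apply: is_derive_line.
    by have := dfs s true sh; rewrite mulr1n.
  by have := dfs s false sh; rewrite mulr0n scaler0 add0r.
have Dphi' s : s \in `]0, h[%R ->
    is_derive s 1 phi (g (s *: v + (h *: w + z)) - g (s *: v + z)).
  by rewrite in_itv/= => /andP[s0 sh]; apply: Dphi; rewrite !ltW.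
have Cphi : {within `[0, h], continuous phi}.
  apply: derivable_within_continuous => s; rewrite in_itv/= => sh.
  by have [] := Dphi s sh.
have [s] := MVT h0 Dphi' Cphi.
rewrite in_itv/= => /andP[s0 sh]; have {s0 sh}sh : 0 <= s <= h by rewrite !ltW.
rewrite {1}/phi /phi scale0r !add0r subr0 => sd.
have -> : second_difference f z v w h =
    (g (s *: v + (h *: w + z)) - g (s *: v + z)) * h.
  by rewrite -sd /second_difference; ring.
pose p : R := 'd g z v; pose q : R := 'd g z w.
have [_ Ht] := Hk s true sh; have [_ Hf] := Hk s false sh.
move: Ht Hf; rewrite mulr0n scaler0 addr0 mulr1n.
have -> : 'd g z (s *: v + h *: w) = s * p + h * q :> R.
  by rewrite linearD !linearZ.
have -> : 'd g z (s *: v) = s * p :> R by rewrite linearZ.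
rewrite addrA (deriveE _ dg) -/q.
exact: increment_estimate.
Unshelve. all: by end_near. Qed.

(** Both mixed derivatives are the limit of the same second difference divided
    by h^2. *)
Lemma derive_comm f U z v w : open U -> U z ->
  (forall x, U x -> differentiable f x) ->
  differentiable ('D_v f) z -> differentiable ('D_w f) z ->
  'D_w ('D_v f) z = 'D_v ('D_w f) z.
Proof.
move=> Uo Uz df dv dw; apply/eqP; rewrite -subr_eq0 -normr_le0.
apply/ler_addgt0Pl => e e0; rewrite addr0.
have e2 : 0 < e / 2 by rewrite divr_gt0.
have A := second_difference_approx w Uo Uz df dv e2.
have B := second_difference_approx v Uo Uz df dw e2.
have [h [[h0 A'] B']] := @filter_ex _ _ _ _ (@filterI _ _ _ _ _
  (@filterI _ _ _ _ _ (nbhs_right_gt (0 : R)) A) B).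
rewrite /= second_differenceC in B'.
exact: quadratic_coef_close h0 A' B'.
Qed.
End Calculus.

(** * The ring of smooth functions on an open set *)

Section SmoothClosure.
Variables (R : realType) (V : normedModType R) (U : set V).
Hypothesis U_open : open U.
Implicit Types (f g : V -> R) (v : V).

Lemma open_near_eq f g z : (forall x, U x -> f x = g x) -> U z ->
  \near z, f z = g z.
Proof.
move=> fg Uz; have : \near z, U z by exact: open_nbhs_nbhs.
by apply: filterS => x /fg.
Qed.

Lemma open_eq_derive f g z v : (forall x, U x -> f x = g x) -> U z ->
  'D_v f z = 'D_v g z.
Proof. by move=> fg Uz; apply: near_eq_derive; exact: open_near_eq. Qed.

(** Smoothness is a statement about all iterated derivatives, awkward to prove
    for a product directly.  This class is closed under differentiation up to
    equality on U ([closure_step]), and a class of differentiable functions with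
    this property consists of smooth functions ([closure_smooth_on]). *)
Inductive smooth_closure : (V -> R) -> Prop :=
| closure_smooth f : smooth_on U f -> smooth_closure f
| closure_affine f : (forall x, U x -> differentiable f x) ->
    (forall v, exists c, forall x, U x -> 'D_v f x = c) -> smooth_closure f
| closureD f g : smooth_closure f -> smooth_closure g ->
    smooth_closure (fun x => f x + g x)
| closureM f g : smooth_closure f -> smooth_closure g ->
    smooth_closure (fun x => f x * g x)
| closureV f : smooth_closure f -> (forall x, U x -> f x != 0) ->
    smooth_closure (fun x => (f x)^-1).

Lemma closure_cst c : smooth_closure (fun=> c).
Proof.
apply: closure_affine => [x _|v]; first exact: differentiable_cst.
by exists 0 => x _; rewrite (derive_cst c).
Qed.

Lemma smooth_derive f v : smooth_on U f -> smooth_on U ('D_v f).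
Proof. by move=> sf s x Ux; have := sf (rcons s v) x Ux; rewrite foldr_rcons. Qed.

Lemma closure_step f : smooth_closure f ->
  (forall x, U x -> differentiable f x) /\
  (forall v, exists2 g, smooth_closure g & forall x, U x -> 'D_v f x = g x).
Proof.
elim=> {f} [f sf|f df cf|f g sf [df Df] sg [dg Dg]|f g sf [df Df] sg [dg Dg]|
            f sf [df Df] f0].
- split=> [x|v]; first exact: (sf [::]).
  by exists ('D_v f) => //; apply: closure_smooth; exact: smooth_derive.
- split=> // v; have [c Dc] := cf v.
  by exists (fun=> c); [exact: closure_cst|].
- split=> [x Ux|v]; first by apply: differentiableD; [exact: df|exact: dg].
  have [f' sf' Df'] := Df v; have [g' sg' Dg'] := Dg v.
  exists (fun x => f' x + g' x); first exact: closureD.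
  move=> x Ux; rewrite -Df'// -Dg'//.
  by apply: deriveD; apply: diff_derivable; [exact: df|exact: dg].
- split=> [x Ux|v]; first by apply: differentiableM; [exact: df|exact: dg].
  have [f' sf' Df'] := Df v; have [g' sg' Dg'] := Dg v.
  exists (fun x => f x * g' x + g x * f' x).
    by apply: closureD; exact: closureM.
  move=> x Ux; rewrite -Df'// -Dg'//.
  by apply: (@deriveM _ _ f g); apply: diff_derivable; [exact: df|exact: dg].
- split=> [x Ux|v]; first by apply: differentiableV; [exact: df|exact: f0].
  have [f' sf' Df'] := Df v.
  exists (fun x => -1 * ((f x)^-1 * (f x)^-1) * f' x).
    apply: closureM => //; apply: closureM; first exact: closure_cst.
    by apply: closureM; exact: closureV.
  move=> x Ux; rewrite -Df'//.
  have dfx : derivable f x v by apply: diff_derivable; exact: df.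
  rewrite (deriveV (f0 x Ux) dfx) /GRing.scale/= mulN1r; congr (- _ * _).
  by rewrite expr2 invfM.
Qed.

Lemma closure_smooth_on f : smooth_closure f -> smooth_on U f.
Proof.
move=> sf s; have : exists2 g, smooth_closure g & forall x, U x ->
    foldr (fun v h => fun z => 'D_v h z) f s x = g x.
  elim: s => [|v s [g sg Eg]]; first by exists f.
  have [g' sg' Dg'] := (closure_step sg).2 v.
  by exists g' => // x Ux /=; rewrite -Dg'//; exact: open_eq_derive.
move=> [g sg Eg] x Ux; apply: (@near_eq_differentiable _ _ g).
  by apply: open_near_eq => // y Uy; rewrite Eg.
exact: (closure_step sg).1.
Qed.

Lemma smoothD f g : smooth_on U f -> smooth_on U g ->
  smooth_on U (fun x => f x + g x).
Proof.
by move=> sf sg; apply: closure_smooth_on; apply: closureD; exact: closure_smooth.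
Qed.

Lemma smoothM f g : smooth_on U f -> smooth_on U g ->
  smooth_on U (fun x => f x * g x).
Proof.
by move=> sf sg; apply: closure_smooth_on; apply: closureM; exact: closure_smooth.
Qed.

Lemma smoothV f : smooth_on U f -> (forall x, U x -> f x != 0) ->
  smooth_on U (fun x => (f x)^-1).
Proof.
by move=> sf f0; apply: closure_smooth_on; apply: closureV => //;
  exact: closure_smooth.
Qed.

Lemma smooth_cst (c : R) : smooth_on U (fun=> c : R).
Proof. by apply: closure_smooth_on; exact: closure_cst. Qed.

Lemma smooth_eq f g : (forall x, U x -> f x = g x) ->
  smooth_on U f -> smooth_on U g.
Proof.
move=> fg sf s x Ux; apply: near_eq_differentiable (sf s x Ux).
apply: open_near_eq => //; elim: s => //= v s IH y Uy.
exact: open_eq_derive.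
Qed.
End SmoothClosure.

(** Functions are normalised to vanish outside U, so that equality on U is
    equality ([smooth_fun_ext]) and the ring laws hold. *)
Record smooth_fun (R : realType) (V : normedModType R) (U : set V)
    (Uo : open U) := SmoothFun {
  sval_fun :> V -> R;
  smooth_funP : smooth_on U sval_fun;
  smooth_fun_out : forall z, ~ U z -> sval_fun z = 0
}.

Section SmoothRing.
Variables (R : realType) (V : normedModType R) (U : set V) (Uo : open U).
Local Notation zeroed f := (fun z => if `[< U z >] then f z else 0).
Local Notation smooth_fun := (smooth_fun Uo).

Lemma smooth_zeroed (f : V -> R) : smooth_on U f -> smooth_on U (zeroed f).
Proof. by apply: smooth_eq => // x Ux; rewrite asboolT. Qed.

Lemma zeroed_out (f : V -> R) z : ~ U z -> zeroed f z = 0.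
Proof. by move=> Uz; rewrite /= asboolF. Qed.

Definition mk_smooth (f : V -> R) (sf : smooth_on U f) : smooth_fun :=
  @SmoothFun _ _ _ Uo _ (smooth_zeroed sf) (zeroed_out f).

Lemma mk_smoothE (f : V -> R) (sf : smooth_on U f) z : U z -> mk_smooth sf z = f z.
Proof. by move=> Uz /=; rewrite asboolT. Qed.

Lemma smooth_fun_ext (a b : smooth_fun) : (forall z, U z -> a z = b z) -> a = b.
Proof.
case: a b => [f sf f0] [g sg g0] /= fg.
have E : f = g.
  apply/funext => z; have [Uz|Uz] := pselect (U z); first exact: fg.
  by rewrite f0// g0.
by case: _ / E sg g0 {fg} => sg g0; congr SmoothFun; exact: Prop_irrelevance.
Qed.

HB.instance Definition _ := gen_eqMixin smooth_fun.
HB.instance Definition _ := gen_choiceMixin smooth_fun.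

Definition sf0 := mk_smooth (smooth_cst Uo 0).
Definition sf1 := mk_smooth (smooth_cst Uo 1).
Definition sfD (a b : smooth_fun) :=
  mk_smooth (smoothD Uo (smooth_funP a) (smooth_funP b)).
Definition sfM (a b : smooth_fun) :=
  mk_smooth (smoothM Uo (smooth_funP a) (smooth_funP b)).
Definition sfN (a : smooth_fun) :=
  mk_smooth (smoothM Uo (smooth_cst Uo (-1)) (smooth_funP a)).

Local Ltac pointwise := move=> *; apply: smooth_fun_ext => z /= /asboolT ->; ring.

Lemma sfDA : associative sfD. Proof. pointwise. Qed.
Lemma sfDC : commutative sfD. Proof. pointwise. Qed.
Lemma sf0D : left_id sf0 sfD. Proof. pointwise. Qed.
Lemma sfND : left_inverse sf0 sfN sfD. Proof. pointwise. Qed.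
Lemma sfMA : associative sfM. Proof. pointwise. Qed.
Lemma sfMC : commutative sfM. Proof. pointwise. Qed.
Lemma sf1M : left_id sf1 sfM. Proof. pointwise. Qed.
Lemma sfMDl : left_distributive sfM sfD. Proof. pointwise. Qed.

HB.instance Definition _ :=
  GRing.isZmodule.Build smooth_fun sfDA sfDC sf0D sfND.
HB.instance Definition _ :=
  GRing.Zmodule_isComPzRing.Build smooth_fun sfMA sfMC sf1M sfMDl.
End SmoothRing.

(** Locked, so that comparing two derivatives does not unfold the limits that
    define them. *)
HB.lock Definition der_fun (R : realType) (V : normedModType R) (U : set V)
    (Uo : open U) (v : V) (a : smooth_fun Uo) : smooth_fun Uo :=
  mk_smooth Uo (smooth_derive v (smooth_funP a)).

Section SmoothRingTheory.
Variables (R : realType) (V : normedModType R) (U : set V) (Uo : open U).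
Local Notation A := (smooth_fun Uo).
Implicit Types (a b : A) (v w : V).

Lemma eval0 z : (0 : A) z = 0.
Proof. by rewrite /=; case: ifP. Qed.

Lemma evalD a b z : (a + b) z = a z + b z.
Proof.
have [Uz|Uz] := pselect (U z); first by rewrite /= asboolT.
by rewrite !smooth_fun_out// addr0.
Qed.

Lemma evalM a b z : (a * b) z = a z * b z.
Proof.
have [Uz|Uz] := pselect (U z); first by rewrite /= asboolT.
by rewrite !smooth_fun_out// mulr0.
Qed.

Lemma eval1 z : U z -> (1 : A) z = 1.
Proof. by move=> Uz /=; rewrite asboolT. Qed.

Lemma evalN a z : (- a) z = - a z.
Proof. by apply: (addrI (a z)); rewrite -evalD !subrr eval0. Qed.

Lemma evalB a b z : (a - b) z = a z - b z.
Proof. by rewrite evalD evalN. Qed.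

Lemma eval_sum n (f : 'I_n -> A) z : (\sum_i f i) z = \sum_i f i z.
Proof.
by elim/big_rec2 : _ => [|i x b _ <-]; [exact: eval0 | exact: evalD].
Qed.

Lemma eval_nat m z : U z -> (m%:R : A) z = m%:R.
Proof.
by move=> Uz; elim: m => [|m IH]; rewrite ?eval0// -!natr1 evalD IH eval1.
Qed.

(** Evaluation at a point of U is a ring morphism. *)
Lemma eval_det n (M : 'M[A]_n) z : U z ->
  (\det M) z = \det (\matrix_(i, j) M i j z).
Proof.
move=> Uz.
have zm : zmod_morphism (fun a : A => a z) by move=> a b; exact: evalB.
have mm : monoid_morphism (fun a : A => a z).
  by split; [exact: eval1 | move=> a b; exact: evalM].
pose ev : {rmorphism A -> R} := HB.pack (fun a : A => a z)
  (GRing.isZmodMorphism.Build A R _ zm) (GRing.isMonoidMorphism.Build A R _ mm).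
rewrite -[LHS]/(ev (\det M)) -det_map_mx; congr (\det _).
by apply/matrixP => i j; rewrite !mxE.
Qed.

Definition const_fun (c : R) : A := mk_smooth Uo (smooth_cst Uo c).
Lemma const_funE c z : U z -> const_fun c z = c.
Proof. exact: mk_smoothE. Qed.

Definition inv_fun a (a0 : forall z, U z -> a z != 0) : A :=
  mk_smooth Uo (smoothV Uo (smooth_funP a) a0).

Lemma mul_inv_fun a (a0 : forall z, U z -> a z != 0) : a * inv_fun a0 = 1.
Proof.
apply: smooth_fun_ext => z Uz; rewrite evalM eval1// mk_smoothE// mulfV//.
exact: a0.
Qed.

Lemma der_funE v a z : U z -> der_fun v a z = 'D_v a z.
Proof. by rewrite der_fun.unlock; exact: mk_smoothE. Qed.

Lemma smooth_fun_diff a z : U z -> differentiable a z.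
Proof. exact: (smooth_funP a [::]). Qed.

Lemma smooth_fun_derivable a v z : U z -> derivable a z v.
Proof. by move=> Uz; apply: diff_derivable; exact: smooth_fun_diff. Qed.

Lemma der_fun_derivation v : derivation (@der_fun R V U Uo v).
Proof.
split=> a b; apply: smooth_fun_ext => z Uz.
  rewrite evalD !der_funE//.
  have -> : 'D_v (a + b) z = 'D_v (fun x => a x + b x) z.
    by apply: (open_eq_derive Uo) => // x _; exact: evalD.
  by apply: deriveD; exact: smooth_fun_derivable.
rewrite evalD !evalM !der_funE//.
have -> : 'D_v (a * b) z = 'D_v (fun x => a x * b x) z.
  by apply: (open_eq_derive Uo) => // x _; exact: evalM.
rewrite (@deriveM _ _ a b); [|exact: smooth_fun_derivable..].
by rewrite addrC [b z *: _]mulrC.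
Qed.

Lemma der_funC v w a : der_fun v (der_fun w a) = der_fun w (der_fun v a).
Proof.
apply: smooth_fun_ext => z Uz.
rewrite !der_funE//.
have step v1 v2 : 'D_v1 (der_fun v2 a) z = 'D_v1 ('D_v2 a) z.
  have E x : U x -> der_fun v2 a x = 'D_v2 a x by exact: der_funE.
  exact: (open_eq_derive Uo v1 E Uz).
rewrite (step v w) (step w v).
have diffD u : differentiable ('D_u a) z.
  exact: (smooth_derive u (smooth_funP a) [::]).
apply: (derive_comm Uo Uz _ (diffD w) (diffD v)) => x.
exact: smooth_fun_diff.
Qed.

Lemma torsion_free_fun m (a : A) : m.+1%:R * a = 0 -> a = 0.
Proof.
move=> ma; apply: smooth_fun_ext => z Uz; apply/eqP.
have /eqP := congr1 (fun b : A => b z) ma.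
by rewrite evalM !eval0 eval_nat// mulf_eq0 pnatr_eq0.
Qed.

Lemma half_fun : 2 * const_fun 2^-1 = 1.
Proof.
apply: smooth_fun_ext => z Uz.
by rewrite evalM eval_nat// const_funE// eval1// mulfV.
Qed.

Lemma near_line (z v : V) : U z -> \forall t \near (0 : R), U (t *: v + z).
Proof.
move=> Uz; have : t *: v + z @[t --> (0 : R)] --> 0 *: v + z.
  by apply: cvgD; [apply: cvgZr_tmp; exact: cvg_id | exact: cvg_cst].
by move=> /(_ U); apply; rewrite scale0r add0r; exact: open_nbhs_nbhs.
Qed.

Lemma derive_along_line a v z : U z ->
  is_derive (0 : R) 1 (fun t : R => a (t *: v + z)) ('D_v a z).
Proof.
move=> Uz; have da : differentiable a (0 *: v + z).
  by rewrite scale0r add0r; exact: smooth_fun_diff.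
by have := is_derive_line da; rewrite scale0r add0r.
Qed.
End SmoothRingTheory.

(** * Coordinates on the tangent bundle *)

Lemma derive_affine (R : realType) (V : normedModType R) (f : V -> R) v z (c : R) :
  (forall h, f (h *: v + z) = h * c + f z) -> 'D_v f z = c.
Proof.
move=> fv; rewrite /derive; apply: lim_near_cst => //.
near=> h; rewrite /= fv addrK /GRing.scale/= mulrA mulVf ?mul1r//.
by near: h; exact: nbhs_dnbhs_neq.
Unshelve. all: by end_near. Qed.

Section Coordinates.
Variables (R : realType) (n : nat).
Local Notation V := ('rV[R]_n * 'rV[R]_n)%type.
Variables (U : set V) (Uo : open U).
Local Notation A := (smooth_fun Uo).

(** The coordinate directions of the base and of the fibre. *)
Definition ex (i : 'I_n) : V := (delta_mx 0 i, 0).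
Definition ey (i : 'I_n) : V := (0, delta_mx 0 i).

Lemma derive_yc k (v z : V) : 'D_v (yc k) z = v.2 0 k.
Proof.
by apply: derive_affine => h; rewrite /yc /= !mxE.
Qed.

Lemma differentiable_yc k (z : V) : differentiable (@yc R n k) z.
Proof.
have lin : linear (@yc R n k : V -> R).
  by move=> c u w; rewrite /yc /= !mxE.
pose f : {linear V -> R} := HB.pack (@yc R n k : V -> R)
  (GRing.isLinear.Build R V R _ (@yc R n k : V -> R) lin).
apply: (@linear_differentiable _ _ _ f) => x.
apply: (@continuous_comp _ _ _ snd (fun M : 'rV[R]_n => M 0 k)).
  exact: cvg_snd.
exact: coord_continuous.
Qed.

Lemma smooth_yc k : smooth_on U (@yc R n k).
Proof.
apply: (closure_smooth_on Uo); apply: closure_affine => [x _|v].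
  exact: differentiable_yc.
by exists (v.2 0 k) => x _; exact: derive_yc.
Qed.

Definition yfun k : A := mk_smooth Uo (smooth_yc k).

Lemma yfunE k z : U z -> yfun k z = z.2 0 k.
Proof. exact: mk_smoothE. Qed.

Lemma der_yfun v k z : U z -> der_fun v (yfun k) z = v.2 0 k.
Proof.
move=> Uz; rewrite der_funE// -(derive_yc k v z).
by apply: (open_eq_derive Uo) => // x Ux; exact: mk_smoothE.
Qed.

Lemma ex_yfun i k : der_fun (ex i) (yfun k) = 0.
Proof. by apply: smooth_fun_ext => z Uz; rewrite der_yfun// eval0 mxE. Qed.

Lemma ey_yfun i k : der_fun (ey i) (yfun k) = (i == k)%:R.
Proof.
by apply: smooth_fun_ext => z Uz; rewrite der_yfun// eval_nat// mxE eqxx eq_sym.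
Qed.

(** A directional derivative along the fibre is linear in the direction. *)
Lemma sum_ey (a : A) (u : 'rV[R]_n) z : U z ->
  \sum_k u 0 k * der_fun (ey k) a z = 'D_(0, u) a z.
Proof.
move=> Uz; have da := smooth_fun_diff a Uz.
under eq_bigr do rewrite der_funE// deriveE//.
rewrite deriveE//.
have -> : (0, u) = \sum_k u 0 k *: ey k.
  rewrite [in LHS](row_sum_delta u) /ey.
  elim/big_rec2: _ => // i x y' _ <-.
  by rewrite /GRing.add/= /add_pair /= scaler0 addr0.
by rewrite linear_sum; apply: eq_bigr => k _; rewrite linearZ.
Qed.
End Coordinates.

(** * The differential ring of a chart *)

(** The derivative at 0 of F^2 (x, y + t y) as a function of t. *)
Lemma is_derive_sqr_ray (R : realType) (c : R) :
  is_derive (0 : R) 1 (fun t : R => (t + 1) ^+ 2 * c) (2 * c).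
Proof.
have -> : (fun t : R => (t + 1) ^+ 2 * c) = (id + cst 1) ^+ 2 * cst c.
  by apply/funext => t; rewrite /= !fctE.
by apply: is_derive_eq; rewrite /GRing.scale /= !fctE; ring.
Qed.

Section ChartRing.
Variables (R : realType) (n : nat).
Local Notation V := ('rV[R]_n * 'rV[R]_n)%type.
Variables (U : set V) (Uo : open U) (F : V -> R).
Hypothesis F_smooth : smooth_on U F.
Hypothesis F_hom : forall z (t : R), U z -> 0 < t -> F (z.1, t *: z.2) = t * F z.
Hypothesis F_pos : forall z, U z -> forall v : 'rV[R]_n, v != 0 ->
  0 < \sum_(a < n) \sum_(b < n) metric F a b z * v 0 a * v 0 b.
Hypothesis slit : forall z, U z -> z.2 != 0.
Local Notation A := (smooth_fun Uo).

(** The local tensors are functions defined everywhere, with arbitrary values off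
    U; this relates them to their counterparts in the ring. *)
Definition rep (f : V -> R) (a : A) : Prop := forall z, U z -> f z = a z.

(** U is open, so derivatives on U only depend on values on U. *)
Lemma rep_dx f a k : rep f a -> rep (dx k f) (der_fun (ex R k) a).
Proof.
by move=> fa z Uz; rewrite der_funE//; exact: (open_eq_derive Uo _ fa Uz).
Qed.

Lemma rep_dy f a k : rep f a -> rep (dy k f) (der_fun (ey R k) a).
Proof.
by move=> fa z Uz; rewrite der_funE//; exact: (open_eq_derive Uo _ fa Uz).
Qed.

Lemma rep_yc k : rep (yc k) (yfun Uo k).
Proof. by move=> z Uz; rewrite yfunE. Qed.

Definition energy_fun : A := mk_smooth Uo (smoothM Uo F_smooth F_smooth).

Lemma rep_energy : rep (Fsq F) energy_fun.
Proof. by move=> z Uz; rewrite mk_smoothE. Qed.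

(** Differentiate F^2 (x, (1 + t) y) = (1 + t)^2 F^2 (x, y) at t = 0. *)
Lemma energy_fun_euler :
  \sum_k yfun Uo k * der_fun (ey R k) energy_fun = 2 * energy_fun.
Proof.
apply: smooth_fun_ext => z Uz; rewrite eval_sum evalM eval_nat//.
under eq_bigr do rewrite evalM yfunE//.
rewrite sum_ey// -(rep_energy Uz).
have [_ <-] := derive_along_line energy_fun (0, z.2) Uz.
have [_ <-] := is_derive_sqr_ray (Fsq F z).
apply: near_eq_derive.
have near_U := near_line Uo (0, z.2) Uz.
have near_pos : \forall t \near (0 : R), 0 < t + 1.
  have : \forall t \near (0 : R), -1 < t by apply: lt_nbhsr; rewrite ltrN10.
  by apply: filterS => t; rewrite -ltrBlDr sub0r.
apply: filterS2 near_U near_pos => t Ut t0.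
rewrite -(rep_energy Ut) /Fsq.
have -> : t *: (0, z.2) + z = (z.1, (t + 1) *: z.2).
  by case: z {Uz Ut} => x y /=;
    rewrite /GRing.add/= /add_pair/= scaler0 add0r scalerDl scale1r.
by rewrite F_hom// exprMn.
Qed.

Definition chart_energy_ring : energy_ring n :=
  @EnergyRing n A (fun i => der_fun (ex R i)) (fun i => der_fun (ey R i))
    (fun i => @der_fun_derivation _ _ _ Uo (ex R i))
    (fun i => @der_fun_derivation _ _ _ Uo (ey R i))
    (fun i j => @der_funC _ _ _ Uo (ey R i) (ey R j))
    (fun i j => @der_funC _ _ _ Uo (ey R i) (ex R j))
    (yfun Uo) (ex_yfun Uo) (ey_yfun Uo) energy_fun energy_fun_euler
    (const_fun Uo 2^-1) (half_fun Uo).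
Local Notation ER := chart_energy_ring.

Lemma rep_metric i j : rep (metric F i j) (metricA ER i j).
Proof.
move=> z Uz; rewrite /metric /metricA evalM const_funE//; congr (_ * _).
exact: (rep_dy _ (rep_dy _ rep_energy)).
Qed.

Lemma rep_y_low i : rep (y_low F i) (y_lowA ER i).
Proof.
move=> z Uz; rewrite /y_low /y_lowA eval_sum; apply: eq_bigr => j _.
by rewrite evalM (rep_metric i j Uz) (rep_yc j Uz).
Qed.

(** By Euler's relation F^2 is the value at y of the positive definite form g. *)
Lemma energy_neq0 z : U z -> energy_fun z != 0.
Proof.
move=> Uz; have := F_pos Uz (slit Uz).
suff -> : \sum_(a < n) \sum_(b < n) metric F a b z * z.2 0 a * z.2 0 b =
  energy_fun z by move=> /lt0r_neq0.
rewrite -[energy_fun](y_y_low ER) eval_sum; apply: eq_bigr => i _.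
rewrite evalM -(rep_y_low i Uz) -(rep_yc i Uz) /y_low mulr_sumr.
by apply: eq_bigr => j _; rewrite /yc; ring.
Qed.

Definition gram : 'M[A]_n := \matrix_(i, j) metricA ER i j.

Lemma eval_gram z : U z ->
  (\matrix_(i, j) gram i j z) = \matrix_(i, j) metric F i j z.
Proof. by move=> Uz; apply/matrixP => i j; rewrite !mxE -(rep_metric i j Uz). Qed.

(** A kernel vector of g would be isotropic for a positive definite form. *)
Lemma det_gram_neq0 z : U z -> (\det gram) z != 0.
Proof.
move=> Uz; rewrite eval_det// eval_gram//; apply/det0P => -[v v0 vM].
have := F_pos Uz v0; suff -> : \sum_(a < n) \sum_(b < n)
    metric F a b z * v 0 a * v 0 b = 0 by rewrite ltxx.
rewrite exchange_big big1// => b _ /=.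
rewrite -mulr_suml; have := congr1 (fun w : 'rV[R]_n => w 0 b) vM; rewrite !mxE.
under eq_bigr do rewrite mxE mulrC.
by move=> ->; rewrite mul0r.
Qed.

(** Cramer's formula, which makes the inverse metric smooth. *)
Definition ginv_fun i j : A := inv_fun det_gram_neq0 * \adj gram i j.

Lemma ginv_funK i j : \sum_l metricA ER i l * ginv_fun l j = (i == j)%:R.
Proof.
have := congr1 (fun M : 'M[A]_n => M i j) (mul_mx_adj gram); rewrite !mxE => E.
rewrite /ginv_fun; under eq_bigr do rewrite mulrCA.
rewrite -mulr_sumr; under eq_bigr => l _.
  rewrite (_ : metricA ER i l = gram i l); last by rewrite mxE.
  over.
rewrite E mulrnAr mulrC mul_inv_fun.
by case: (i == j).
Qed.

Definition chart_finsler_ring : finsler_ring n :=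
  @FinslerRing n ER (inv_fun energy_neq0) (mul_inv_fun energy_neq0)
    ginv_fun ginv_funK (@torsion_free_fun _ _ _ Uo).
Local Notation FR := chart_finsler_ring.

Lemma rep_metric_inv i j : rep (metric_inv F i j) (@ginv n FR i j).
Proof.
move=> z Uz; rewrite /metric_inv.
set M := \matrix_(a, b) metric F a b z.
have MW : M *m (\matrix_(a, b) ginv_fun a b z) = 1%:M.
  apply/matrixP => a b; rewrite !mxE -(eval_nat Uo _ Uz) -ginv_funK eval_sum.
  apply: eq_bigr => l _; rewrite evalM -(rep_metric a l Uz).
  by congr (_ * _); rewrite mxE.
have [Mu _] := mulmx1_unit MW.
by rewrite -[invmx M]mulmx1 -MW mulKmx// mxE.
Qed.

(** * Local tensors in the differential ring *)

Lemma rep_spray i : rep (spray F i) (@sprayA n FR i).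
Proof.
move=> z Uz; rewrite /spray /sprayA evalM; congr (_ * _).
  by rewrite evalM !const_funE// -invfM -natrM.
rewrite eval_sum; apply: eq_bigr => l _.
rewrite evalM -(rep_metric_inv i l Uz) evalB eval_sum; congr (_ * (_ - _)).
  apply: eq_bigr => k _; rewrite evalM -(rep_yc k Uz); congr (_ * _).
  exact: (rep_dx _ (rep_dy _ rep_energy)).
exact: (rep_dx _ rep_energy).
Qed.

Lemma rep_conn i k : rep (conn F i k) (@connA n FR i k).
Proof. exact: (rep_dy _ (@rep_spray i)). Qed.

Lemma rep_conn_dy i j k : rep (conn_dy F i j k) (@conn_dyA n FR i j k).
Proof. exact: (rep_dy _ (@rep_conn i k)). Qed.

Lemma rep_berwald i j k l : rep (berwald F i j k l) (@berwaldA n FR i j k l).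
Proof. exact: (rep_dy _ (@rep_conn_dy i k l)). Qed.

Lemma rep_mean_berwald j k : rep (mean_berwald F j k) (@mean_berwaldA n FR j k).
Proof.
move=> z Uz; rewrite /mean_berwald /mean_berwaldA evalM const_funE// eval_sum.
by congr (_ * _); apply: eq_bigr => m _; exact: rep_berwald.
Qed.

Lemma rep_hdelta k f (a : A) : rep f a -> rep (hdelta F k f) (@hdeltaA n FR k a).
Proof.
move=> fa z Uz; rewrite /hdelta hdeltaAE evalB eval_sum; congr (_ - _).
  exact: (rep_dx k fa).
apply: eq_bigr => m _; rewrite evalM -(rep_conn m k Uz); congr (_ * _).
exact: (rep_dy m fa).
Qed.

Lemma rep_hcov2 T (S : 'I_n -> 'I_n -> A) i j k :
  (forall i j, rep (T i j) (S i j)) ->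
  rep (hcov2 F T i j k) (@hcov2A n FR S i j k).
Proof.
move=> TS z Uz; rewrite /hcov2 /hcov2A !evalB !eval_sum (rep_hdelta k (TS i j) Uz).
congr (_ - _ - _); apply: eq_bigr => m _;
  by rewrite evalM -(TS _ _ _ Uz) -(rep_conn_dy _ _ _ Uz).
Qed.

Lemma rep_hcov3 T (S : 'I_n -> 'I_n -> 'I_n -> A) i j k l :
  (forall i j k, rep (T i j k) (S i j k)) ->
  rep (hcov3 F T i j k l) (@hcov3A n FR S i j k l).
Proof.
move=> TS z Uz; rewrite /hcov3 /hcov3A !evalB !eval_sum.
rewrite (rep_hdelta l (TS i j k) Uz).
congr (_ - _ - _ - _); apply: eq_bigr => m _;
  by rewrite evalM -(TS _ _ _ _ Uz) -(rep_conn_dy _ _ _ Uz).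
Qed.

Lemma rep_cartan i j k : rep (cartan F i j k) (@cartanA n FR i j k).
Proof.
move=> z Uz; rewrite /cartan /cartanA evalM const_funE//; congr (_ * _).
exact: (rep_dy _ (@rep_metric i j)).
Qed.

Lemma rep_landsberg i j k : rep (landsberg F i j k) (@landsbergA n FR i j k).
Proof.
move=> z Uz; rewrite /landsberg /landsbergA eval_sum; apply: eq_bigr => s _.
by rewrite evalM -(rep_yc s Uz) (rep_hcov3 _ _ _ _ rep_cartan Uz).
Qed.

Lemma rep_stretch i j k l : rep (stretch F i j k l) (@stretchA n FR i j k l).
Proof.
move=> z Uz; rewrite /stretch /stretchA evalM eval_nat// evalB.
by rewrite !(rep_hcov3 _ _ _ _ rep_landsberg Uz).
Qed.

Lemma rep_mean_berwald_bar j k l :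
  rep (mean_berwald_bar F j k l) (@mean_berwald_barA n FR j k l).
Proof. exact: rep_hcov2 rep_mean_berwald. Qed.

Lemma rep_riemann i k : rep (riemann F i k) (@riemannA n FR i k).
Proof.
move=> z Uz; rewrite /riemann /riemannA evalB evalD evalB !evalM !eval_nat// !eval_sum.
congr (_ * _ - _ + _ * _ - _).
- exact: (rep_dx k (@rep_spray i)).
- apply: eq_bigr => j _; rewrite evalM -(rep_yc j Uz); congr (_ * _).
  exact: (rep_dx j (@rep_conn i k)).
- apply: eq_bigr => j _; rewrite evalM -(rep_spray j Uz); congr (_ * _).
  exact: rep_conn_dy.
- by apply: eq_bigr => j _; rewrite evalM -(rep_conn i j Uz) -(rep_conn j k Uz).
Qed.

Lemma rep_angular i j : rep (angular F i j) (@angularA n FR i j).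
Proof.
move=> z Uz; rewrite /angular /angularA evalB.
rewrite [X in _ = _ - X]evalM [X in _ = _ - X * _]evalM.
congr (_ - _ * _ * _).
- exact: rep_metric.
- exact: rep_y_low.
- exact: rep_y_low.
- by rewrite mk_smoothE// -(rep_energy Uz).
Qed.

Lemma rep_angular_mixed i j : rep (angular_mixed F i j) (@angular_mixedA n FR i j).
Proof.
move=> z Uz; rewrite /angular_mixed /angular_mixedA evalB.
rewrite [X in _ = _ - X]evalM [X in _ = _ - X * _]evalM eval_nat//.
congr (_ - _ * _ * _).
- exact: rep_yc.
- exact: rep_y_low.
- by rewrite mk_smoothE// -(rep_energy Uz).
Qed.

(** * Dependence on the fibre coordinate *)

Definition fiber_eq (x : 'rV[R]_n) (a b : A) : Prop :=
  forall y, U (x, y) -> a (x, y) = b (x, y).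

(** A vertical derivative only involves the values on the fibre, so functions that
    agree on one fibre have equal vertical derivatives there. *)
Lemma fiber_eq_dY x a b k : fiber_eq x a b ->
  fiber_eq x (der_fun (ey R k) a) (der_fun (ey R k) b).
Proof.
move=> ab y Uxy; rewrite !der_funE//.
have [_ <-] := derive_along_line a (ey R k) Uxy.
have [_ <-] := derive_along_line b (ey R k) Uxy.
apply: near_eq_derive; apply: filterS (near_line Uo (ey R k) Uxy) => t.
have -> : t *: ey R k + (x, y) = (x, t *: delta_mx 0 k + y).
  by rewrite /GRing.add/= /add_pair/= scaler0 add0r.
exact: ab.
Qed.

Lemma der_const v c : der_fun v (const_fun Uo c) = 0.
Proof.
apply: smooth_fun_ext => z Uz; rewrite der_funE// eval0.
rewrite -[RHS](derive_cst c z v); apply: (open_eq_derive Uo) => // x.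
exact: const_funE.
Qed.

Lemma dY3_quadratic i j k p q c : let D m := der_fun (ey R m) in
  D i (D j (D k (const_fun Uo c * yfun Uo p * yfun Uo q))) = 0.
Proof.
move=> D; have DM m (a b : A) : D m (a * b) = D m a * b + a * D m b.
  exact: (derM (der_fun_derivation Uo (ey R m))).
have DD m (a b : A) : D m (a + b) = D m a + D m b.
  exact: (derD (der_fun_derivation Uo (ey R m))).
have Dc m : D m (const_fun Uo c) = 0 by exact: der_const.
have Db m (b : bool) : D m b%:R = 0.
  exact: (der_bool (der_fun_derivation Uo (ey R m))).
have D0 m : D m 0 = 0 by exact: (der0 (der_fun_derivation Uo (ey R m))).
have Dy m l : D m (yfun Uo l) = (m == l)%:R by exact: ey_yfun.
do 3!rewrite ?(DM, DD, Dc, Db, D0, Dy).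
ring.
Qed.

(** On a fibre R^i_k agrees with a quadratic form in y, whose third vertical
    derivatives vanish. *)
Lemma dY3_riem :
  (forall i k z, U z -> exists a : 'M[R]_n, forall y, U (z.1, y) ->
    riemann F i k (z.1, y) =
      \sum_(j < n) \sum_(l < n) a j l * y 0 j * y 0 l) ->
  forall a b c i k, @dY n FR a (@dY n FR b (@dY n FR c (@riemannA n FR i k))) = 0.
Proof.
move=> Rq a b c i k; apply: smooth_fun_ext => -[x y] Uz.
have [q Eq] := Rq i k _ Uz.
pose Q : A := \sum_j \sum_l const_fun Uo (q j l) * yfun Uo j * yfun Uo l.
have RQ : fiber_eq x (@riemannA n FR i k) Q.
  move=> y' Uy'; rewrite -(rep_riemann i k Uy') Eq// eval_sum.
  apply: eq_bigr => j _; rewrite eval_sum; apply: eq_bigr => l _.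
  by rewrite !evalM const_funE// !yfunE.
rewrite (fiber_eq_dY a (fiber_eq_dY b (fiber_eq_dY c RQ)) Uz).
rewrite eval0 -(eval0 Uo (x, y)); congr (sval_fun _ _).
have dS m (f : 'I_n -> A) : der_fun (ey R m) (\sum_j f j) =
    \sum_j der_fun (ey R m) (f j).
  exact: (der_sum (der_fun_derivation Uo (ey R m))).
rewrite /Q !dS big1// => j _; rewrite !dS big1// => l _.
exact: dY3_quadratic.
Qed.

Hypothesis fiber_full : forall x y y', U (x, y) -> y' != 0 -> U (x, y').
Hypothesis n_gt2 : (2 < n)%N.

Lemma segment_eq (w : A) x (y y' : 'rV[R]_n) :
  (forall m, der_fun (ey R m) w = 0) ->
  (forall s : R, 0 <= s <= 1 -> U (x, s *: (y' - y) + y)) ->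
  w (x, y') = w (x, y).
Proof.
move=> w0 Us.
have E s : s *: ((0, y' - y) : V) + (x, y) = (x, s *: (y' - y) + y).
  by rewrite /GRing.add/= /add_pair/= scaler0 add0r.
have := @mvt_line R V w (0, y' - y) (x, y) 1 ltr01.
case=> [s s1|s s1]; first by rewrite E; apply: smooth_fun_diff; exact: Us.
rewrite !E -sum_ey; last exact: Us.
rewrite scale1r subrK mul1r big1.
  by move=> /eqP; rewrite subr_eq0 => /eqP.
by move=> k _; rewrite w0 eval0 mulr0.
Qed.

(** The segment avoids the origin: its k-th coordinate vanishes only at y. *)
Lemma segment_coord (w : A) x (y y' : 'rV[R]_n) k :
  (forall m, der_fun (ey R m) w = 0) -> U (x, y) ->
  y != 0 -> y 0 k = 0 -> y' 0 k != 0 -> w (x, y') = w (x, y).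
Proof.
move=> w0 Uxy y0 yk y'k; apply: segment_eq => // s _.
have [->|s0] := eqVneq s 0; first by rewrite scale0r add0r.
apply: fiber_full Uxy _; apply/eqP => /(congr1 (fun v : 'rV[R]_n => v 0 k)).
rewrite !mxE yk subr0 addr0 => /eqP.
by rewrite mulf_eq0 (negbTE s0) (negbTE y'k).
Qed.

(** R^n minus the origin is connected by segments in coordinate position: a
    vector off the first axis is joined to e_0 directly, one on the axis through
    e_1. *)
Lemma fiber_const (w : A) x y y' : (forall m, der_fun (ey R m) w = 0) ->
  U (x, y) -> U (x, y') -> w (x, y) = w (x, y').
Proof.
move=> w0.
have n0 : (0 < n)%N by exact: leq_trans n_gt2.
have n1 : (1 < n)%N by exact: leq_trans n_gt2.
pose k0 := Ordinal n0; pose k1 := Ordinal n1.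
pose e k : 'rV[R]_n := delta_mx 0 k.
have e_neq0 k : e k != 0.
  by apply/eqP => /(congr1 (fun v : 'rV[R]_n => v 0 k)); rewrite !mxE !eqxx => /eqP;
    rewrite oner_eq0.
suff H u : U (x, u) -> w (x, u) = w (x, e k0) by move=> /H -> /H ->.
move=> Uu; have u0 : u != 0 by exact: slit Uu.
have Ue k : U (x, e k) by exact: fiber_full Uu _.
have [k /andP[k0k uk]|uk] := pickP (fun k => (k != k0) && (u 0 k != 0)).
  apply: (segment_coord (k := k)) => //.
  by rewrite mxE (negbTE k0k).
have uk1 : u 0 k1 = 0 by apply/eqP; have := uk k1 => /= /negbFE.
have ek1 : e k1 0 k1 != 0 by rewrite mxE !eqxx oner_eq0.
rewrite -(segment_coord w0 Uu u0 uk1 ek1).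
by rewrite (segment_coord w0 (Ue k0) (e_neq0 k0) _ ek1)// mxE.
Qed.

(** In [riemann_quadratic] the coefficients have zero vertical derivatives, so
    they may be replaced by their values at one point of the fibre. *)
Lemma fiber_quadratic :
  (forall a b i k l, @dY n FR a (@dY n FR b (@nl_curvature n FR i k l)) = 0) ->
  forall i k z, U z -> exists a : 'M[R]_n, forall y, U (z.1, y) ->
    riemann F i k (z.1, y) =
      \sum_(j < n) \sum_(l < n) a j l * y 0 j * y 0 l.
Proof.
move=> Om0 i k [x y0] Uz /=.
exists (\matrix_(j, l) @dY n FR j (@nl_curvature n FR i k l) (x, y0)) => y Uy.
rewrite (rep_riemann i k Uy) riemann_quadratic eval_sum.
apply: eq_bigr => j _; rewrite eval_sum; apply: eq_bigr => l _.
rewrite !evalM mxE -!(rep_yc _ Uy); congr (_ * _ * _).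
by apply: fiber_const => // m; exact: Om0.
Qed.

(** * The equivalence in one chart *)

(** The metric has degree 0. *)
Lemma cartan_y j k : \sum_m @cartanA n FR j k m * @coordy n FR m = 0.
Proof.
transitivity (@half n FR * euler (metricA FR j k)); last by rewrite euler_metric mulr0.
rewrite /euler mulr_sumr; apply: eq_bigr => m _.
by rewrite /cartanA -mulrA [X in _ * X]mulrC.
Qed.

(** The operations of the chart ring are those of smooth functions only up to
    unfolding; stating the evaluation rules for them keeps rewriting
    syntactic. *)
Lemma chart_evalM (a b : FR) z :
  (a * b : FR) z = (a : A) z * (b : A) z :> R.
Proof. exact: evalM. Qed.

Lemma chart_evalD (a b : FR) z :
  (a + b : FR) z = (a : A) z + (b : A) z :> R.
Proof. exact: evalD. Qed.

Lemma chart_eval_sum m (f : 'I_m -> FR) z :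
  (\sum_i f i : FR) z = \sum_i (f i : A) z :> R.
Proof. exact: eval_sum. Qed.

Section IsotropicChart.
Variables mu lam : V -> R.
Hypothesis isoF : forall z, U z -> forall i j k l : 'I_n,
  berwald F i j k l z = mu z * cartan F j k l z * ell F i z
    + lam z * (angular_mixed F i j z * angular F k l z
               + angular_mixed F i k z * angular F j l z
               + angular_mixed F i l z * angular F j k z).

Lemma eval_angular_sum i j k l z : U z -> @angular_sum n FR i j k l z =
  angular_mixed F i j z * angular F k l z
  + angular_mixed F i k z * angular F j l z
  + angular_mixed F i l z * angular F j k z.
Proof.
move=> Uz; have hh a b c d : (@angular_mixedA n FR a b * @angularA n FR c d) z =
    angular_mixed F a b z * angular F c d z.
  rewrite (rep_angular_mixed a b Uz) (rep_angular c d Uz); exact: chart_evalM.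
exact: etrans (chart_evalD _ _ _) (congr2 +%R
  (etrans (chart_evalD _ _ _) (congr2 +%R (hh i j k l) (hh i k j l)))
  (hh i l j k)).
Qed.

Lemma eval_isotropic i j k l z : U z ->
  @berwaldA n FR i j k l z = mu z * @cartanA n FR j k l z * (@coordy n FR i z / F z)
    + lam z * @angular_sum n FR i j k l z.
Proof.
move=> Uz; rewrite -(rep_berwald i j k l Uz) (isoF Uz) (eval_angular_sum _ _ _ _ Uz).
by rewrite /ell (rep_yc i Uz) (rep_cartan j k l Uz).
Qed.

Lemma F_neq0 z : U z -> F z != 0.
Proof.
by move=> Uz; have := energy_neq0 Uz; rewrite -(rep_energy Uz) /Fsq expf_eq0.
Qed.

(** The isotropy condition contracted with y_i, which kills the angular terms. *)
Lemma eval_berwald_low j k l z : U z ->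
  @berwald_low n FR j k l z = mu z * @cartanA n FR j k l z * F z.
Proof.
move=> Uz; rewrite /berwald_low chart_eval_sum.
under eq_bigr do rewrite chart_evalM eval_isotropic// mulrDr.
rewrite big_split /=.
have -> : \sum_m @y_lowA n FR m z * (lam z * @angular_sum n FR m j k l z) = 0.
  have := congr1 (fun a : A => a z) (@y_low_angular_sum n FR j k l).
  rewrite chart_eval_sum eval0 => /(congr1 ( *%R (lam z))).
  rewrite mulr0 mulr_sumr => E; rewrite -[RHS]E.
  by apply: eq_bigr => m _; rewrite chart_evalM mulrCA.
have E : \sum_m @coordy n FR m z * @y_lowA n FR m z = F z ^+ 2.
  rewrite [RHS](rep_energy Uz) -[energy_fun](y_y_low ER) chart_eval_sum.
  by apply: eq_bigr => m _; rewrite chart_evalM.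
rewrite addr0; transitivity (mu z * @cartanA n FR j k l z / F z *
    (\sum_m @coordy n FR m z * @y_lowA n FR m z)).
  have gen (a b c d f : R) : a * (b * c * (d / f)) = b * c / f * (d * a) by ring.
  by rewrite mulr_sumr; apply: eq_bigr => m _; exact: gen.
by rewrite E expr2 [LHS]mulrA divfK//; exact: F_neq0.
Qed.

(** The function lambda is only given pointwise; this double trace of the Berwald
    curvature is smooth and equal to it ([lam_funE]). *)
Definition lam_fun : A :=
  const_fun Uo ((n%:R + 1) * (n%:R - 1))^-1 *
  \sum_k \sum_l (\sum_m @berwaldA n FR m k l m) * @ginv n FR l k.

Lemma lam_funE z : U z -> lam_fun z = lam z.
Proof.
move=> Uz; have tr k l : (\sum_m @berwaldA n FR m k l m) z =
    lam z * ((n%:R + 1) * @angularA n FR k l z).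
  rewrite chart_eval_sum; under eq_bigr do rewrite eval_isotropic//.
  rewrite big_split /= -mulr_sumr.
  have -> : \sum_m mu z * @cartanA n FR k l m z * (@coordy n FR m z / F z) = 0.
    have := congr1 (fun a : A => a z) (cartan_y k l).
    rewrite chart_eval_sum eval0 => /(congr1 ( *%R (mu z / F z))).
    rewrite mulr0 mulr_sumr => E; rewrite -[RHS]E.
    have gen (b c d f : R) : b * c * (d / f) = b / f * (c * d) by ring.
    by apply: eq_bigr => m _; rewrite chart_evalM; exact: gen.
  rewrite add0r; have := congr1 (fun a : A => a z) (@angular_sum_trace n FR k l).
  by rewrite chart_eval_sum chart_evalM chart_evalD eval_nat// eval1// => ->.
have n1 : (n%:R - 1 : R) != 0.
  by rewrite subr_eq0 pnatr_eq1; case: (n) n_gt2 => [|[]].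
have n2 : (n%:R + 1 : R) != 0 by rewrite natr1 pnatr_eq0.
rewrite /lam_fun chart_evalM const_funE//.
have -> : (\sum_k \sum_l (\sum_m @berwaldA n FR m k l m) * @ginv n FR l k) z =
    lam z * (n%:R + 1) * (n%:R - 1).
  have := congr1 (fun a : A => a z) (@angular_trace n FR).
  rewrite evalB eval_nat// eval1// chart_eval_sum => <-.
  rewrite chart_eval_sum mulr_sumr; apply: eq_bigr => k _.
  rewrite !chart_eval_sum mulr_sumr; apply: eq_bigr => l _.
  by rewrite chart_evalM tr chart_evalM; ring.
by field; rewrite n1 n2.
Qed.

(** [eval_berwald_low] turns mu C_jkl / F into P_jkl / F^2. *)
Lemma isotropic_chart : @isotropic n FR lam_fun.
Proof.
move=> i j k l; apply: smooth_fun_ext => z Uz.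
rewrite eval_isotropic//.
rewrite [RHS]chart_evalD; congr (_ + _); last first.
  by rewrite chart_evalM lam_funE.
rewrite chart_evalM chart_evalM eval_berwald_low//.
have -> : @energyV n FR z = (F z ^+ 2)^-1.
  by rewrite mk_smoothE// -(rep_energy Uz).
by field; exact: F_neq0.
Qed.

Lemma chart_equivalence :
  (forall i k z, U z -> exists a : 'M[R]_n, forall y, U (z.1, y) ->
    riemann F i k (z.1, y) =
      \sum_(j < n) \sum_(l < n) a j l * y 0 j * y 0 l) <->
  (forall z, U z -> forall i j k l, stretch F i j k l z = 0) /\
  (forall z, U z -> forall j k l, mean_berwald_bar F j k l z = 0).
Proof.
have [main1 main2] := isotropic_curvature_iff isotropic_chart n_gt2.
split=> [Rq|[st e]].
  have [st e] := main1 (curvature_linear_of_riemann (dY3_riem Rq)).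
  split=> [z Uz i j k l|z Uz j k l].
    by rewrite (rep_stretch i j k l Uz) st eval0.
  by rewrite (rep_mean_berwald_bar j k l Uz) e eval0.
apply: fiber_quadratic; apply: main2; split=> [i j k l|j k l].
  by apply: smooth_fun_ext => z Uz; rewrite -(rep_stretch i j k l Uz) st// eval0.
by apply: smooth_fun_ext => z Uz; rewrite -(rep_mean_berwald_bar j k l Uz) e// eval0.
Qed.
End IsotropicChart.
End ChartRing.

(** * The equivalence on the manifold *)

Section FinslerManifold.
Variables (R : realType) (n : nat) (M : smooth_manifold R n).

Lemma slit_domain_open (c : chart_index M) : open (slit_domain c).
Proof.
apply: openI.
  apply: (@open_comp _ _ fst) => [z _|]; first exact: cvg_fst.
  exact: chart_image_open.
suff : open ((snd : 'rV[R]_n * 'rV[R]_n -> 'rV[R]_n) @^-1` (~` [set 0])) by [].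
apply: open_comp => [z _|]; first exact: cvg_snd.
apply: closed_openC; apply: accessible_closed_set1; apply: hausdorff_accessible.
exact: norm_hausdorff.
Qed.
End FinslerManifold.

Theorem theorem1p3 (R : realType) (n : nat) (M : smooth_manifold R n)
    (F : tangent_bundle M -> R) :
  (2 < n)%N ->
  finsler_metric F ->
  generalized_isotropic_berwald F ->
  (R_quadratic F <-> stretch_metric F /\ mean_berwald_bar_vanishes F).
Proof.
move=> n_gt2 [_ F_smooth F_hom F_pos] [mu [lam [_ _ iso]]].
have chart_hom c z (t : R) : slit_domain c z -> 0 < t ->
    local_expr F c (z.1, t *: z.2) = t * local_expr F c z.
  by case: z => x y [cx _] t0; exact: F_hom.
have slit c z : @slit_domain R n M c z -> z.2 != 0 by move=> [_ /eqP].
have full c x y y' : @slit_domain R n M c (x, y) -> y' != 0 ->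
    slit_domain c (x, y') by move=> [cx _] /eqP.
have chartP c := chart_equivalence (@slit_domain_open R n M c) (F_smooth c) (chart_hom c)
  (@F_pos c) (slit c) (full c) n_gt2 (iso c).
split=> [Rq|[st e] c x cx i k].
  have main c := (chartP c).1.
  have quad c i k z : slit_domain c z -> exists a : 'M[R]_n, forall y,
      slit_domain c (z.1, y) -> riemann (local_expr F c) i k (z.1, y) =
        \sum_(j < n) \sum_(l < n) a j l * y 0 j * y 0 l.
    move=> [cz _]; have [a Ea] := Rq c z.1 cz i k.
    by exists a => y [_ y0]; exact: Ea.
  split=> c z Uz; [exact: (main c (quad c)).1|exact: (main c (quad c)).2].
have n0 : (0 < n)%N by exact: leq_trans n_gt2.
pose e0 : 'rV[R]_n := delta_mx 0 (Ordinal n0).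
have e0_neq0 : e0 <> 0.
  move/(congr1 (fun v : 'rV[R]_n => v 0 (Ordinal n0))); rewrite !mxE !eqxx.
  by move/eqP; rewrite oner_eq0.
have [a Ea] := (chartP c).2 (conj (st c) (e c)) i k (x, e0) (conj cx e0_neq0).
by exists a => y y0; apply: Ea; split.
Qed.
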